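(* Let $q$ be an odd prime power and let $G_n(\mathbb{F}_q)$ be one of the three families $O_{2n+1}(\mathbb{F}_q)$, $O^+_{2n}(\mathbb{F}_q)$, $O^-_{2n}(\mathbb{F}_q)$ described below. For all orthogonal modified types $\boldsymbol\mu,\boldsymbol\nu,\boldsymbol\lambda$ (for this family) there exist polynomials $r_{\boldsymbol\mu,\boldsymbol\nu}^{\boldsymbol\lambda}\in\mathcal{R}_q[\tfrac12]$, only finitely many nonzero for fixed $\boldsymbol\mu,\boldsymbol\nu$, such that for every integer $m\ge0$, in $Z(\mathbb{Z}G_m(\mathbb{F}_q))$, \[ X_{\boldsymbol\mu,m}X_{\boldsymbol\nu,m}=\sum_{\boldsymbol\lambda}r_{\boldsymbol\mu,\boldsymbol\nu}^{\boldsymbol\lambda}([m]_q)\,X_{\boldsymbol\lambda,m}. \]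
   Context: $q$ odd. The three families are symmetry groups $\{g: B_n(gx,gy)=B_n(x,y)\}$ of the following symmetric bilinear forms: $O^+_{2n}$: $B_n(x,y)=\sum_{i=1}^n(x_{2i-1}y_{2i}+x_{2i}y_{2i-1})$ on $\mathbb{F}_q^{2n}$; $O^-_{2n}$: $B_n(x,y)=x_1y_1-\epsilon x_2y_2+\sum_{i=2}^n(x_{2i-1}y_{2i}+x_{2i}y_{2i-1})$ on $\mathbb{F}_q^{2n}$ with $\epsilon$ a fixed non-square in $\mathbb{F}_q$; $O_{2n+1}$: $B_n(x,y)=x_1y_1+\sum_{i=1}^n(x_{2i}y_{2i+1}+x_{2i+1}y_{2i})$ on $\mathbb{F}_q^{2n+1}$. In each family $G_n\subset G_{n+1}$ via $g\mapsto\operatorname{diag}(g,\mathrm{Id}_2)$. Elements $g\in G_n$, $g'\in G_{n'}$ have the same orthogonal modified type if for some $N\ge n,n'$ their images in $G_N$ are conjugate in $G_N$; an orthogonal modified type is such an equivalence class, with size $|\boldsymbol\mu|=\operatorname{rank}(g-\mathrm{Id})$ for $g$ in the class. $X_{\boldsymbol\mu,m}$ is the sum of all elements of $G_m(\mathbb{F}_q)$ of modified type $\boldsymbol\mu$ (zero if none). $[m]_q=(q^m-1)/(q-1)$; $\binom{x}{k}_q=\frac{x(x-[1]_q)\cdots(x-[k-1]_q)}{q^{k(k-1)/2}[k]_q!}$; $\mathcal{R}_q[\tfrac12]$ is the set of $\mathbb{Z}[\tfrac12,q,q^{-1}]$-linear combinations in $\mathbb{Q}[x]$ of the $\binom{x}{k}_q$,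 $k\ge0$. *)

(* Defs.v *)
From HB Require Import structures.
From mathcomp Require Import all_boot all_order all_algebra all_field.
From mathcomp Require Import boolp.
Set Implicit Arguments.
Unset Strict Implicit.
Unset Printing Implicit Defensive.
Import GRing.Theory Num.Theory.
Local Open Scope ring_scope.

Inductive ofamily := OddO | PlusO | MinusO.

Definition fdim (fam : ofamily) (n : nat) : nat :=
  match fam with OddO => n.*2.+1 | _ => n.*2 end.

(* smallest admissible index n (the O^-_{2n} form needs n >= 1) *)
Definition nmin (fam : ofamily) : nat := if fam is MinusO then 1%N else 0%N.

(* Gram matrix of B_n, with 0-based coordinates:
   O^+_{2n}: x_{2i-1}y_{2i}+x_{2i}y_{2i-1}  -> pairs {2k,2k+1};
   O^-_{2n}: x_1y_1 - eps x_2y_2 + pairs {2k,2k+1}, k >= 1;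
   O_{2n+1}: x_1y_1 + pairs {2k+1,2k+2}. *)
Definition formB (F : fieldType) (eps : F) (fam : ofamily) (n : nat)
  : 'M[F]_(fdim fam n) :=
  \matrix_(i, j)
   match fam with
   | PlusO => (((i : nat)./2 == (j : nat)./2) && ((i : nat) != j))%:R
   | MinusO =>
       if ((i < 2) && (j < 2))%N then
         (if (i : nat) == j then (if (i : nat) == 0%N then 1 else - eps) else 0)
       else (((i : nat)./2 == (j : nat)./2) && ((i : nat) != j))%:R
   | OddO =>
       if ((i : nat) == 0%N) || ((j : nat) == 0%N) then ((i : nat) == j)%:R
       else ((((i : nat).-1)./2 == ((j : nat).-1)./2) && ((i : nat) != j))%:R
   end.

Definition inG (F : fieldType) (eps : F) (fam : ofamily) (n : nat)
  (g : 'M[F]_(fdim fam n)) : bool :=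
  g^T *m formB eps fam n *m g == formB eps fam n.

Definition embed (F : fieldType) (fam : ofamily) (n N : nat)
  (g : 'M[F]_(fdim fam n)) : 'M[F]_(fdim fam N) :=
  \matrix_(i, j)
   match @insub _ (fun k => (k < fdim fam n)%N) 'I_(fdim fam n) (i : nat),
         @insub _ (fun k => (k < fdim fam n)%N) 'I_(fdim fam n) (j : nat) with
   | Some i', Some j' => g i' j'
   | _, _ => ((i : nat) == j)%:R
   end.

Definition elt (F : fieldType) (fam : ofamily) := {n : nat & 'M[F]_(fdim fam n)}.

Definition sametype (F : fieldType) (eps : F) (fam : ofamily)
  (a b : elt F fam) : Prop :=
  exists N : nat, [/\ (projT1 a <= N)%N, (projT1 b <= N)%N &
    exists c : 'M[F]_(fdim fam N),
      [/\ inG eps c, c \in unitmx &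
          embed N (projT2 b) = invmx c *m embed N (projT2 a) *m c]].

Definition hasType (F : fieldType) (eps : F) (fam : ofamily) (m : nat)
  (h : 'M[F]_(fdim fam m)) (mu : elt F fam) : bool :=
  inG eps h && `[< sametype eps (existT _ m h) mu >].

(* coefficient at h of X_{mu,m} X_{nu,m} in the group algebra of G_m *)
Definition prodCoef (F : finFieldType) (eps : F) (fam : ofamily) (m : nat)
  (mu nu : elt F fam) (h : 'M[F]_(fdim fam m)) : rat :=
  \sum_(x : 'M[F]_(fdim fam m))
    \sum_(y : 'M[F]_(fdim fam m) | x *m y == h)
      ((hasType eps x mu && hasType eps y nu) : nat)%:R.

Definition XCoef (F : finFieldType) (eps : F) (fam : ofamily) (m : nat)
  (lam : elt F fam) (h : 'M[F]_(fdim fam m)) : rat :=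
  (hasType eps h lam : nat)%:R.

Definition qint (q m : nat) : rat := (q%:R ^+ m - 1) / (q%:R - 1).

Definition qbinomp (q k : nat) : {poly rat} :=
  (q%:R ^+ 'C(k, 2) * \prod_(1 <= i < k.+1) qint q i)^-1
    *: \prod_(i < k) ('X - (qint q i)%:P).

Definition inZ2q (q : nat) (c : rat) : Prop :=
  exists (a : int) (i j : nat), c = a%:~R / (2%:R ^+ i * q%:R ^+ j).

Definition inRq (q : nat) (p : {poly rat}) : Prop :=
  exists (K : nat) (c : nat -> rat),
    (forall k, inZ2q q (c k)) /\ p = \sum_(k < K) c k *: qbinomp q k.

(* Main.v *)
Require Import Defs.
From HB Require Import structures.
From mathcomp Require Import all_boot all_order all_algebra all_field.
From mathcomp Require Import fingroup cyclic mxabelem boolp.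
From mathcomp Require Import ring zify.
Import Order.TTheory GRing.Theory Num.Theory.
Set Implicit Arguments.
Unset Strict Implicit.
Unset Printing Implicit Defensive.
Local Open Scope ring_scope.

(* Every isometry is g = 1 + I A I^T B with I injective and A invertible (the Wall form), where
   the Gram matrix of I is determined by A.  By a stable version of Witt's theorem the modified
   type of g is exactly the congruence class of A, so there are finitely many types of bounded
   rank.  For a fixed h in G_n, the coefficient of X_mu X_nu at the image of h in G_(n+m) counts
   pairs of such matrices (I, J).  Split the rows of X = [I | J] into the old coordinates X0 and
   the 2m new hyperbolic ones (a, b): the Gram condition reads a^T b + b^T a = S, and all other
   conditions depend only on X0, on I^T B J and on the row space of (a, b).  The number of (a, b)
   with given S and given row space is a polynomial in q^m, by a recursion on m that admits only
   the exponentials q^(jm).  Polynomials attached to elements of the same type agree at all large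
   m, hence are equal.  Finally, a rational polynomial taking integral values at [m]_q for all
   large m lies in R_q, because q is invertible in Z[1/q] and so the values recur modulo any
   denominator prime to q. *)

(** * Integrality of polynomials in [m]_q *)

Section Integrality.

Variable q : nat.
Hypothesis q_gt1 : (1 < q)%N.

Lemma qB1_neq0 : q%:R - 1 != 0 :> rat.
Proof. by rewrite subr_eq0 (eqr_nat rat q 1) gtn_eqF. Qed.

Lemma q_neq0 : q%:R != 0 :> rat.
Proof. by rewrite pnatr_eq0 -lt0n ltnW. Qed.

Lemma qint0 : qint q 0 = 0.
Proof. by rewrite /qint expr0 subrr mul0r. Qed.

Lemma qintS m : qint q m.+1 = 1 + q%:R * qint q m.
Proof. by rewrite /qint exprS; field; exact: qB1_neq0. Qed.

Lemma qint_sum m : qint q m = (\sum_(i < m) q ^ i)%N%:R.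
Proof.
elim: m => [|m IH]; first by rewrite big_ord0 qint0.
rewrite qintS IH big_ord_recl natrD expn0 -natrM big_distrr /=.
by congr (_ + _%:R); apply: eq_bigr => i _; rewrite expnS.
Qed.

Lemma qintD m n : qint q (m + n) = qint q m + q%:R ^+ m * qint q n.
Proof. by rewrite /qint exprD; field; exact: qB1_neq0. Qed.

Lemma qint_exp m : q%:R ^+ m = 1 + (q%:R - 1) * qint q m.
Proof. by rewrite /qint; field; exact: qB1_neq0. Qed.

Lemma qint_neq0 m : qint q m.+1 != 0.
Proof.
by rewrite qint_sum pnatr_eq0 big_ord_recl expn0.
Qed.

(** The subring Z[1/q]: some power of q clears the denominator. *)
Definition intq (c : rat) : Prop := exists j : nat, q%:R ^+ j * c \is a Num.int.

Lemma int_intq c : c \is a Num.int -> intq c.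
Proof. by exists 0%N; rewrite expr0 mul1r. Qed.

Lemma intqD a b : intq a -> intq b -> intq (a + b).
Proof.
move=> [i Hi] [j Hj]; exists (i + j)%N.
have -> : q%:R ^+ (i + j) * (a + b) = q%:R ^+ j * (q%:R ^+ i * a) + q%:R ^+ i * (q%:R ^+ j * b).
  by rewrite exprD; ring.
by rewrite rpredD // rpredM // rpredX ?rpred_nat.
Qed.

Lemma intqM a b : intq a -> intq b -> intq (a * b).
Proof.
move=> [i Hi] [j Hj]; exists (i + j)%N.
have -> : q%:R ^+ (i + j) * (a * b) = (q%:R ^+ i * a) * (q%:R ^+ j * b) by rewrite exprD; ring.
exact: rpredM.
Qed.

Lemma intqN a : intq a -> intq (- a).
Proof. by move=> [i Hi]; exists i; rewrite mulrN rpredN. Qed.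

Lemma intq_sum n (f : 'I_n -> rat) : (forall i, intq (f i)) -> intq (\sum_i f i).
Proof.
move=> H; apply: (big_ind intq) => [|a b|i _]; last exact: H.
- by apply: int_intq; exact: rpred0.
- exact: intqD.
Qed.

Lemma intq_inZ2q c : intq c -> inZ2q q c.
Proof.
move=> [j /intrP [a Ha]]; exists a, 0%N, j.
by rewrite expr0 mul1r -Ha mulrAC mulfV ?mul1r // expf_neq0 ?q_neq0.
Qed.

Lemma qbinomp0 : qbinomp q 0 = 1.
Proof. by rewrite /qbinomp big_ord0 big_nil bin0n expr0 mulr1 invr1 scale1r. Qed.

Lemma qbinompS k :
  qbinomp q k.+1 =
    (q%:R ^+ k * qint q k.+1)^-1 *: (qbinomp q k * ('X - (qint q k)%:P)).
Proof.
rewrite /qbinomp big_ord_recr big_nat_recr //= binS bin1 exprD -scalerAl scalerA.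
congr (_ *: _); rewrite -invfM; congr (_^-1); ring.
Qed.

Lemma qbinompS_horner k x :
  (qbinomp q k.+1).[x] =
    (q%:R ^+ k * qint q k.+1)^-1 * ((qbinomp q k).[x] * (x - qint q k)).
Proof. by rewrite qbinompS hornerZ hornerM hornerXsubC. Qed.

(** The q-Pascal rule as an identity valid at every rational x: for x = [m] the argument 1 + q x is
    [m+1]. It yields both the integrality of the values and the diagonal value 1 by induction on
    m. *)
Lemma qbinomp_pascal k x :
  (qbinomp q k.+1).[1 + q%:R * x] =
    q%:R ^+ k.+1 * (qbinomp q k.+1).[x] + (qbinomp q k).[x].
Proof.
have qk j : q%:R ^+ j != 0 :> rat by rewrite expf_neq0 ?q_neq0.
elim: k => [|k IH].
  rewrite !qbinompS_horner qbinomp0 !hornerC qint0 qintS qint0.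
  by rewrite expr0 expr1; field.
rewrite !(qbinompS_horner k.+1) IH !(qbinompS_horner k) qintS (qintS k) !exprS.
have := qint_neq0 k; have := qint_neq0 k.+1; rewrite !qintS => H1 H2.
by field; rewrite q_neq0 qk H1 H2.
Qed.

Lemma qbinomp_horner_small k m : (m < k)%N -> (qbinomp q k).[qint q m] = 0.
Proof.
move=> mk; rewrite hornerZ horner_prod (bigD1 (Ordinal mk)) //= hornerXsubC subrr.
by rewrite mul0r mulr0.
Qed.

Lemma qbinomp_horner_diag m : (qbinomp q m).[qint q m] = 1.
Proof.
elim: m => [|m IH]; first by rewrite qbinomp0 hornerC.
by rewrite qintS qbinomp_pascal IH qbinomp_horner_small // mulr0 add0r.
Qed.

Lemma qbinomp_horner_int k m : (qbinomp q k).[qint q m] \is a Num.int.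
Proof.
elim: m k => [|m IH] [|k].
- by rewrite qbinomp0 hornerC rpred1.
- by rewrite qbinomp_horner_small ?rpred0.
- by rewrite qbinomp0 hornerC rpred1.
- by rewrite qintS qbinomp_pascal rpredD ?rpredM ?rpredX ?rpred_nat.
Qed.

Lemma size_qbinomp k : size (qbinomp q k) = k.+1.
Proof.
rewrite size_scale; last first.
  rewrite invr_neq0 // mulf_neq0 ?expf_neq0 ?q_neq0 //.
  by rewrite big_add1 big_mkord; apply/prodf_neq0 => i _; exact: qint_neq0.
by rewrite size_prod_XsubC /index_enum unlock -enumT size_enum_ord.
Qed.

Lemma qbinomp_span n (p : {poly rat}) : (size p <= n)%N ->
  exists c : nat -> rat, p = \sum_(k < n) c k *: qbinomp q k.
Proof.
elim: n p => [|n IH] p.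
  by rewrite leqn0 size_poly_eq0 => /eqP ->; exists (fun=> 0); rewrite big_ord0.
(* Subtracting [a] times the basis element of degree n cancels the coefficient of degree n. *)
move=> sp; pose a := p`_n / lead_coef (qbinomp q n).
have lc0 : lead_coef (qbinomp q n) != 0 by rewrite lead_coef_eq0 -size_poly_eq0 size_qbinomp.
have [|c Hc] := IH (p - a *: qbinomp q n).
  apply/leq_sizeP => j; rewrite leq_eqVlt coefB coefZ => /orP [/eqP <-|nj].
    by rewrite /a lead_coefE size_qbinomp /= divfK ?subrr // -[X in _`_X]/(n.+1.-1) -(size_qbinomp n) -lead_coefE.
  rewrite !nth_default ?mulr0 ?subrr //; first by rewrite size_qbinomp.
  exact: leq_trans nj.
exists (fun k => if k == n then a else c k); rewrite big_ord_recr /= eqxx.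
rewrite -[p](subrK (a *: qbinomp q n)) Hc; congr (_ + _); apply: eq_bigr => i _.
by rewrite ltn_eqF.
Qed.

(* Evaluating at [0], [1], ... gives a unitriangular integral system for the coefficients. *)
Lemma inRq_values (p : {poly rat}) : (forall m, intq p.[qint q m]) -> inRq q p.
Proof.
move=> H; have [c Hc] := qbinomp_span (leqnn (size p)).
(* Past the degree the coefficients are set to 0, since [inRq] requires every c k to be integral. *)
exists (size p), (fun k => if (k < size p)%N then c k else 0); split; last first.
  by rewrite [LHS]Hc; apply: eq_bigr => i _; rewrite ltn_ord.
move=> k; apply: intq_inZ2q; case: ltnP => [|_]; last by apply: int_intq; exact: rpred0.
elim/ltn_ind: k => k IH kp.
(* At [k] the terms of index above k vanish and the k-th contributes c k itself; the earlier ones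
   are integral by induction. *)
have := H k; rewrite Hc horner_sum (bigID (fun i : 'I__ => (i < k)%N)) /=.
rewrite [X in _ + X](bigD1 (Ordinal kp)) ?ltnn //= hornerZ qbinomp_horner_diag mulr1.
rewrite [X in _ + (_ + X)]big1 => [|i]; last first.
  rewrite -leqNgt => /andP [ki ik]; rewrite hornerZ qbinomp_horner_small ?mulr0 //.
  rewrite ltn_neqAle ki andbT eq_sym; apply: contraNneq ik => E.
  by apply/eqP/val_inj.
rewrite addr0 => Hk; rewrite -[c k](addKr (\sum_(i < size p | (i < k)%N) (c i *: qbinomp q i).[qint q k])).
apply: intqD => //; apply: intqN; rewrite big_mkcond /=; apply: intq_sum => i.
case: ifP => [ik|_]; last by apply: int_intq; exact: rpred0.
by rewrite hornerZ; apply: intqM; [exact: IH|apply: int_intq; exact: qbinomp_horner_int].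
Qed.

(** Pigeonhole: two of the D + 1 powers q^0, ..., q^D agree modulo D. *)
Lemma expn_eventually_periodic D : (0 < D)%N ->
  exists j e : nat, (0 < e)%N /\ (D %| q ^ j * (q ^ e - 1))%N.
Proof.
move=> D0; pose f (i : 'I_D.+1) : 'I_D := Ordinal (ltn_pmod (q ^ i) D0).
have /injectiveP/injectivePn : ~ injective f.
  by move=> /leq_card; rewrite !card_ord ltnn.
move=> [i [j ij /(congr1 val) /= E]].
wlog lt_ij : i j ij E / (i < j)%N.
  by move=> W; case: (ltngtP i j) => [/W|/W|/val_inj/eqP/idPn]; [apply|apply; rewrite // eq_sym|].
exists i, (j - i)%N; split; first by rewrite subn_gt0.
rewrite mulnBr muln1 -expnD subnKC; last exact: ltnW.
by rewrite -eqn_mod_dvd ?leq_pexp2l 1?ltnW // E.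
Qed.

Lemma poly_int_sub (p : {poly int}) (x y : int) : (y - x %| p.[y] - p.[x])%Z.
Proof.
elim/poly_ind: p => [|p c IH]; first by rewrite !horner0 subrr dvdz0.
rewrite !hornerMXaddC.
have -> : p.[y] * y + c - (p.[x] * x + c) = (p.[y] - p.[x]) * y + p.[x] * (y - x) by ring.
by apply: rpredD; [apply: dvdz_mulr | apply: dvdz_mull].
Qed.

(* Only large values need to be integral: since q is invertible, values of p recur modulo its denominator. *)
Lemma inRq_large_values (p : {poly rat}) n :
  (forall m, (n <= m)%N -> p.[qint q m] \is a Num.int) -> inRq q p.
Proof.
move=> H; apply: inRq_values => m.
have [p' [D D0 Hp]] := rat_poly_scale p.
(* The factor q - 1 is included because q^e - 1 = (q - 1)[e]; dividing it out leaves D dividing q^j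
   [e]. *)
have D1 : (0 < `|D| * (q - 1))%N by rewrite muln_gt0 absz_gt0 D0 subn_gt0.
have [j [e [e0 De]]] := expn_eventually_periodic D1.
(* M is at least n, so p is integral at [M], and [M] - [m] = q^m [e t] is a multiple of [e]. *)
pose t := n; pose M := (m + e * t)%N.
have nM : (n <= M)%N by rewrite /M /t (leq_trans _ (leq_addl _ _)) // leq_pmull.
exists j.
have [x Hx] : exists x : nat, qint q m = x%:R by exists (\sum_(i < m) q ^ i)%N; rewrite qint_sum.
have [y Hy] : exists x : nat, qint q M = x%:R by exists (\sum_(i < M) q ^ i)%N; rewrite qint_sum.
rewrite -[p.[_]](subrK p.[qint q M]) mulrDr rpredD //; last by rewrite rpredM ?H ?rpredX ?rpred_nat.
have ev (z : nat) : p.[z%:R] = D%:~R^-1 * (p'.[z%:Z])%:~R.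
  by rewrite Hp hornerZ -[z%:R]/((z%:Z)%:~R) horner_map.
rewrite Hx Hy !ev -mulrBr mulrCA -intrB.
have /dvdzP [w ->] := poly_int_sub p' y x.
have -> : (w * (x%:Z - y%:Z))%:~R = - (w%:~R * (q%:R ^+ m * qint q (e * t))) :> rat.
  rewrite rmorphM rmorphB /= -!pmulrn -Hx -Hy /M qintD; ring.
rewrite !mulrN rpredN.
have -> : D%:~R^-1 * (q%:R ^+ j * (w%:~R * (q%:R ^+ m * qint q (e * t)))) =
   (w%:~R * q%:R ^+ m) * (D%:~R^-1 * (q%:R ^+ j * qint q (e * t))) by move=> *; ring.
apply: rpredM; first by rewrite rpredM ?rpredX ?rpred_nat ?intr_int.
have V u : exists v : nat, qint q (e * u) = qint q e * v%:R.
  elim: u => [|u [v Hv]]; first by exists 0%N; rewrite muln0 qint0 mulr0.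
  by exists (1 + q ^ e * v)%N; rewrite mulnS qintD Hv natrD natrM natrX; ring.
have [v Hv] := V t.
rewrite Hv (mulrA (q%:R ^+ j)) mulrA; apply: rpredM; last exact: rpred_nat.
have /dvdnP [u Hu] := De.
have /(congr1 (fun z : nat => z%:R : rat)) := Hu.
have q1 : (0 < q)%N by exact: ltnW.
rewrite !natrM !natrB ?expn_gt0 ?q1 // natrX natrX qint_exp.
rewrite (addrC 1) addrK => Hu'.
have -> : D%:~R^-1 * (q%:R ^+ j * qint q e) = u%:R * ((`|D|%N)%:R / D%:~R).
  apply: (mulfI qB1_neq0); rewrite mulrCA (mulrCA _ (q%:R ^+ j)) Hu'; ring.
apply: rpredM; first exact: rpred_nat.
rewrite natr_absz.
by case: ger0P => _; rewrite ?rmorphN ?mulNr ?rpredN divff ?intr_eq0 ?rpred1.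
Qed.

End Integrality.

(** * Counting hyperbolic pairs with a given Gram matrix *)

Section ExponentialPolynomials.

Variable Q : rat.

(** Linear combinations of the exponentials Q^(jN) with j at least e. The lower bound e is what the
    recursion below keeps track of. *)
Definition exp_poly (e : nat) (u : nat -> rat) : Prop :=
  exists p : {poly rat}, forall N, u N = Q ^+ (e * N) * p.[Q ^+ N].

Lemma exp_polyD e u v : exp_poly e u -> exp_poly e v -> exp_poly e (fun N => u N + v N).
Proof. by move=> [p Hp] [p' Hp']; exists (p + p') => N; rewrite Hp Hp' hornerD mulrDr. Qed.

Lemma exp_polyZ e u c : exp_poly e u -> exp_poly e (fun N => c * u N).
Proof. by move=> [p Hp]; exists (c *: p) => N; rewrite Hp hornerZ mulrCA. Qed.

Lemma exp_poly0 e : exp_poly e (fun=> 0).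
Proof. by exists 0 => N; rewrite horner0 mulr0. Qed.

Lemma eq_exp_poly e u v : (forall N, u N = v N) -> exp_poly e v -> exp_poly e u.
Proof. by move=> uv [p Hp]; exists p => N; rewrite uv. Qed.

Lemma exp_poly_sum e (I : finType) (P : pred I) (u : I -> nat -> rat) :
  (forall i, P i -> exp_poly e (u i)) -> exp_poly e (fun N => \sum_(i | P i) u i N).
Proof.
move=> H; have -> : (fun N => \sum_(i | P i) u i N) = \big[(fun u v N => u N + v N)/fun=> 0]_(i | P i) u i.
  by apply/funext => N; elim/big_rec2: _ => // i x y _ ->.
apply: (big_ind (exp_poly e)) => //; first exact: exp_poly0.
exact: exp_polyD.
Qed.

Lemma exp_poly_weaken e u : exp_poly e u -> exp_poly 0 u.
Proof.
move=> [p Hp]; exists ('X^e * p) => N.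
by rewrite Hp hornerM hornerXn mul0n expr0 mul1r -exprM mulnC.
Qed.

(* The forcing term only involves exponents larger than e, so there is no resonance. *)
Lemma exp_poly_rec e u w : 1 < Q ->
  (forall N, u N.+1 = Q ^+ e * u N + w N) -> exp_poly e.+1 w -> exp_poly e u.
Proof.
move=> Q1 uS [p Hp].
have Q0 : Q != 0 by rewrite gt_eqF // (lt_trans _ Q1) ?ltr01.
have QS i : Q ^+ i.+1 - 1 != 0 by rewrite subr_eq0 gt_eqF // exprn_egt1.
(* Dividing u by Q^(eN) turns the recursion into a difference equation. [r] solves it monomial by
   monomial, and [c] adjusts the initial value. *)
pose r : {poly rat} := \sum_(i < size p) (p`_i / (Q ^+ e * (Q ^+ i.+1 - 1))) *: 'X^(i.+1).
pose c := u 0%N - r.[1].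
exists (c%:P + r); elim=> [|N IH]; first by rewrite muln0 expr0 mul1r hornerD hornerC subrK.
have key : r.[Q ^+ N.+1] = r.[Q ^+ N] + Q ^+ N * p.[Q ^+ N] / Q ^+ e.
  rewrite !horner_sum [p.[_]]horner_coef mulr_sumr mulr_suml -big_split /=.
  apply: eq_bigr => i _; rewrite !hornerZ !hornerXn -!exprM mulSn !exprD !mulnS !exprD.
  have := QS i; rewrite exprS => H.
  by field; rewrite H expf_neq0.
rewrite uS IH Hp !hornerD !hornerC key mulnS mulSn !exprD.
by field; rewrite expf_neq0.
Qed.

End ExponentialPolynomials.

Lemma big_col_mx (F : finNzRingType) m n k (f : 'M[F]_(m + n, k) -> nat) :
  (\sum_a f a = \sum_a \sum_b f (col_mx a b))%N.
Proof.
rewrite pair_bigA /= (reindex (fun p : 'M_(m, k) * 'M_(n, k) => col_mx p.1 p.2)) //.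
exists (fun a => (usubmx a, dsubmx a)) => [[a b]|a] _ /=; last by rewrite vsubmxK.
by rewrite col_mxKu col_mxKd.
Qed.

(** * Pairs (a, b) with prescribed symmetrised product, counted row by row *)

Section HyperbolicCount.

Variables (F : finFieldType) (k K : nat) (R : 'M[F]_(k, K)).

Let sy N (a b : 'M[F]_(N, k)) : 'M_k := a^T *m b + b^T *m a.

(** [A] collects rows of a that have already been split off, while their partners [u] remain to be
    chosen. Carrying [A] along makes the recursion on N close up. *)
Let ok l (A : 'M[F]_(l, k)) (S : 'M_K) (X : 'M_k) : bool :=
  [exists u : 'M_(l, k), R^T *m (X + sy A u) *m R == S].

Let cnt l (A : 'M[F]_(l, k)) (S : 'M_K) (N : nat) : nat :=
  (\sum_(a : 'M_(N, k)) \sum_(b : 'M_(N, k)) ok A S (sy a b))%N.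

Let sy_col m n (a b : 'M_(m, k)) (c d : 'M_(n, k)) :
  sy (col_mx a c) (col_mx b d) = sy a b + sy c d.
Proof. by rewrite /sy !tr_col_mx !mul_row_col addrACA. Qed.

Let syDr N (a b c : 'M_(N, k)) : sy a (b + c) = sy a b + sy a c.
Proof. by rewrite /sy mulmxDr [(b + c)^T]linearD mulmxDl addrACA. Qed.

Let syMl m n (c : 'M_(m, n)) (a : 'M_(n, k)) b : sy (c *m a) b = sy a (c^T *m b).
Proof. by rewrite /sy !trmx_mul trmxK !mulmxA. Qed.

(** If a = c A, then the contribution of the pair (a, b) is absorbed by shifting [u] by c^T b. *)
Let ok_in l (A : 'M_(l, k)) S m (a b : 'M_(m, k)) X :
  (a <= A)%MS -> ok A S (sy a b + X) = ok A S X.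
Proof.
move=> /submxP [c ->]; rewrite syMl.
apply/existsP/existsP => -[u /eqP Hu].
  by exists (c^T *m b + u); rewrite syDr addrCA addrA Hu.
exists (u - c^T *m b).
by rewrite addrAC -syDr [_ + (u - _)]addrC subrK [_ + X]addrC Hu.
Qed.

(** The admissible b are either none or a coset of the solutions of the homogeneous problem, and
    they exist exactly when the problem with a added to the rows of [A] is solvable. *)
Let ok_notin l (A : 'M_(l, k)) S m (a : 'M_(m, k)) X :
  (\sum_b ok A S (sy a b + X) = (\sum_b ok A 0%R (sy a b)) * ok (col_mx a A) S X)%N.
Proof.
have okE : ok (col_mx a A) S X = [exists b, ok A S (sy a b + X)].
  apply/existsP/existsP => [[u /eqP Hu]|[b /existsP [u /eqP Hu]]].
    exists (usubmx u); apply/existsP; exists (dsubmx u).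
    by move: Hu; rewrite -{1}[u]vsubmxK sy_col addrCA addrA => ->.
  by exists (col_mx b u); rewrite sy_col addrCA addrA Hu.
rewrite okE; case: (boolP [exists b, _]) => [/existsP [b0 Hb0]|/existsPn H]; last first.
  by rewrite muln0 big1 // => b _; rewrite (negbTE (H b)).
rewrite muln1 (reindex (fun b => b + b0)) /=; last first.
  by exists (fun b => b - b0) => b _; rewrite ?addrK ?subrK.
apply: eq_bigr => b _; congr (nat_of_bool _).
move/existsP: Hb0 => [u0 /eqP Hu0].
have key u u1 : u1 = u + u0 -> R^T *m (sy a (b + b0) + X + sy A u1) *m R =
    R^T *m (sy a b + sy A u) *m R + S.
  move=> ->; rewrite -Hu0 -mulmxDl -mulmxDr !syDr; congr (_ *m _ *m _).
  by rewrite [RHS]addrACA [sy A u + sy A u0]addrC addrA -!addrA.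
apply/existsP/existsP => -[u /eqP Hu].
  exists (u - u0); apply/eqP; apply: (addIr S).
  by rewrite -(key _ u) ?subrK // Hu add0r.
by exists (u + u0); rewrite (key u) // Hu add0r.
Qed.

(** Split off the first rows of a and b. A row a in the span of [A] allows all q^k partners, and
    there are q^(rank A) such rows; any other a enlarges [A]. *)
Let cntS l (A : 'M_(l, k)) S N :
  (cnt A S N.+1 = #|F| ^ (k + \rank A) * cnt A S N
    + \sum_(a : 'rV_k | ~~ (a <= A)%MS)
        (\sum_(b : 'rV_k) ok A 0%R (sy a b)) * cnt (col_mx a A) S N)%N.
Proof.
rewrite {1}/cnt (@big_col_mx _ 1 N).
have E a : (\sum_(a' : 'M_(N, k)) \sum_b ok A S (sy (col_mx a a') b)
   = \sum_(a' : 'M_(N, k)) \sum_(b' : 'M_(N, k)) \sum_(b : 'rV_k) ok A S (sy a b + sy a' b'))%N.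
  apply: eq_bigr => a' _; rewrite (@big_col_mx _ 1 N) exchange_big.
  by do 2! apply: eq_bigr => ? _; rewrite sy_col.
rewrite (eq_bigr _ (fun a _ => E a)) {E} (bigID (fun a : 'rV_k => (a <= A)%MS)) /=; congr addn.
  have -> : (#|F| ^ (k + \rank A) = \sum_(a : 'rV[F]_k | (a <= A)%MS) \sum_(b : 'rV[F]_k) 1)%N.
    rewrite !sum_nat_const muln1 card_mx mul1n expnD mulnC -card_rowg; congr (_ * _)%N.
    by rewrite -sum1_card -sum1_card; apply: eq_bigl => a; rewrite mem_rowg.
  rewrite big_distrl /=; apply: eq_bigr => a aA.
  rewrite sum_nat_const muln1 big_distrr /=; apply: eq_bigr => a' _.
  rewrite big_distrr /=; apply: eq_bigr => b' _.
  by rewrite -sum_nat_const; apply: eq_bigr => b _; rewrite ok_in.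
apply: eq_bigr => a aA; rewrite /cnt big_distrr /=; apply: eq_bigr => a' _.
by rewrite big_distrr /=; apply: eq_bigr => b' _; rewrite ok_notin.
Qed.

Let Q : rat := (#|F|)%:R.

Let Q_gt1 : 1 < Q.
Proof. by rewrite /Q ltr1n finNzRing_gt1. Qed.

(** Induction on the corank of [A]. The forcing terms belong to matrices of rank one more, so their
    exponents start at k + rank A + 1, just above the homogeneous exponent. *)
Let cnt_poly l (A : 'M_(l, k)) S :
  exp_poly Q (k + \rank A) (fun N => (cnt A S N)%:R).
Proof.
have [d] : exists d, d = (k - \rank A)%N by eexists.
elim/ltn_ind: d l A => d IH l A dE.
apply: (exp_poly_rec Q_gt1 (w := fun N => \sum_(a : 'rV_k | ~~ (a <= A)%MS)
   (\sum_(b : 'rV_k) ok A 0%R (sy a b))%N%:R * (cnt (col_mx a A) S N)%:R)).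
  move=> N; rewrite cntS natrD natrM natrX; congr (_ + _); rewrite natr_sum.
  by apply: eq_bigr => a _; rewrite natrM.
apply: exp_poly_sum => a aA; apply: exp_polyZ.
have rk : \rank (col_mx a A) = (\rank A).+1.
  apply/eqP; rewrite eqn_leq -addsmxE; apply/andP; split.
    by rewrite (leq_trans (mxrank_adds_leqif _ _)) // -[leqRHS]add1n leq_add2r rank_leq_row.
  have : (A < a + A)%MS by rewrite ltmxE addsmxSr addsmx_sub submx_refl andbT.
  by rewrite ltmxErank => /andP [].
rewrite -addnS -rk; apply: (IH (k - \rank (col_mx a A))%N) => //.
rewrite dE rk ltn_sub2l // -rk; exact: rank_leq_col.
Qed.

Lemma hyperbolic_count_poly (S : 'M[F]_K) :
  exp_poly Q 0 (fun N => (\sum_(a : 'M[F]_(N, k)) \sum_(b : 'M[F]_(N, k))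
     (R^T *m (a^T *m b + b^T *m a) *m R == S))%N%:R).
Proof.
(* With an [A] of no rows the existential over [u] is vacuous and the plain count is recovered. *)
apply: (@eq_exp_poly _ _ _ (fun N => (cnt (0 : 'M_(0, k)) S N)%:R)).
  move=> N; congr (_%:R); do 2! apply: eq_bigr => ? _; congr nat_of_bool.
  apply/idP/existsP => [H|[u]]; last by rewrite /sy !flatmx0 trmx0 !mul0mx !addr0.
  by exists 0; rewrite [sy 0 0]/sy trmx0 mul0mx !addr0.
exact: exp_poly_weaken (cnt_poly _ _).
Qed.

End HyperbolicCount.

(** * Refining the count by the row space of the stacked matrix (a, b) *)

Section RowSpaceCount.

Variables (F : finFieldType) (K : nat) (S : 'M[F]_K).

Let Q : rat := (#|F|)%:R.

Let gram N (a b : 'M[F]_(N, K)) : bool := a^T *m b + b^T *m a == S.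

Let below (W : 'M[F]_K) N : nat :=
  (\sum_(a : 'M[F]_(N, K)) \sum_(b : 'M[F]_(N, K))
     [&& (a <= W)%MS, (b <= W)%MS & gram a b])%N.

Let exactly (W : 'M[F]_K) N : nat :=
  (\sum_(a : 'M[F]_(N, K)) \sum_(b : 'M[F]_(N, K))
     ((<<col_mx a b>>%MS == W) && gram a b))%N.

Let big_below (W : 'M[F]_K) N (f : 'M[F]_(N, K) -> nat) :
  (\sum_(a | (a <= W)%MS) f a = \sum_(a : 'M[F]_(N, \rank W)) f (a *m row_base W))%N.
Proof.
rewrite (reindex_onto (fun a : 'M_(N, \rank W) => a *m row_base W)
   (fun a => a *m pinvmx (row_base W))) /=.
  apply: eq_bigl => a; rewrite (submx_trans (submxMl _ _)) ?eq_row_base //=.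
  apply/eqP/(row_free_inj (row_base_free W)).
  by rewrite mulmxKpV // submxMl.
by move=> a aW; rewrite mulmxKpV // eq_row_base.
Qed.

(** In coordinates with respect to a basis of W, the matrices a and b become unrestricted, and the
    basis matrix takes the role of [R] in the hyperbolic count. *)
Let below_poly W : exp_poly Q 0 (fun N => (below W N)%:R).
Proof.
apply: eq_exp_poly (hyperbolic_count_poly (row_base W) S) => N; congr (_%:R).
have -> : below W N = (\sum_(a : 'M_(N, K) | (a <= W)%MS) \sum_(b : 'M_(N, K) | (b <= W)%MS) gram a b)%N.
  rewrite [RHS]big_mkcond; apply: eq_bigr => a _; case: (a <= W)%MS => /=; last by rewrite big1.
  by rewrite [RHS]big_mkcond; apply: eq_bigr => b _; case: (b <= W)%MS.
rewrite (big_below W (fun a => \sum_(b | (b <= W)%MS) gram a b)%N).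
apply: eq_bigr => a _; rewrite (big_below W (fun b => gram (a *m row_base W) b : nat)).
apply: eq_bigr => b _; congr nat_of_bool.
by rewrite /gram !trmx_mul mulmxDr mulmxDl !mulmxA.
Qed.

Let below_exactly W N : (below W N = \sum_(V : 'M_K | (V <= W)%MS) exactly V N)%N.
Proof.
rewrite /exactly exchange_big; apply: eq_bigr => a _.
rewrite exchange_big; apply: eq_bigr => b _.
rewrite (big_mkcond (fun V => (V <= W)%MS)) (bigD1 <<col_mx a b>>%MS) //= eqxx genmxE.
rewrite col_mx_sub big1 ?addn0 => [|V]; first by case: (a <= W)%MS; case: (b <= W)%MS.
by rewrite eq_sym => /negbTE ->; rewrite if_same.
Qed.

(** Induction on the rank of W: remove from [below] the contributions of the proper subspaces. A W
    that is not the canonical matrix of its row space is never attained, so its count is 0. *)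
Let exactly_poly W : exp_poly Q 0 (fun N => (exactly W N)%:R).
Proof.
have [d] : exists d, d = \rank W by eexists.
elim/ltn_ind: d W => d IH W dW.
case: (eqVneq <<W>>%MS W) => [WW|WW]; last first.
  apply: eq_exp_poly (exp_poly0 Q 0) => N.
  rewrite /exactly big1 // => a _; rewrite big1 // => b _.
  by case: eqP => // E; move: WW; rewrite -E genmx_id eqxx.
apply: (@eq_exp_poly _ _ _ (fun N => (below W N)%:R + -1 * \sum_(V | (V <= W)%MS && (V != W)) (exactly V N)%:R)).
  move=> N; rewrite below_exactly (bigD1 W) //= natrD natr_sum.
  by rewrite mulN1r addrK.
apply: exp_polyD; first exact: below_poly.
apply: exp_polyZ; apply: exp_poly_sum => V /andP [VW nVW].
case: (eqVneq <<V>>%MS V) => [VV|VV]; last first.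
  apply: eq_exp_poly (exp_poly0 Q 0) => N.
  rewrite /exactly big1 // => a _; rewrite big1 // => b _.
  by case: eqP => // E; move: VV; rewrite -E genmx_id eqxx.
apply: (IH (\rank V)) => //; rewrite dW ltn_neqAle (mxrankS VW) andbT.
apply: contraNneq nVW => rVW; rewrite -VV -WW; apply/eqP/eq_genmx.
by apply/eqmxP; rewrite -(geq_leqif (mxrank_leqif_eq VW)) rVW.
Qed.

(* Moebius inversion over the lattice of row spaces, represented by the canonical matrices <<W>>. *)
Lemma row_space_count_poly (phi : 'M[F]_K -> bool) :
  exp_poly (#|F|)%:R 0 (fun N => (\sum_(a : 'M[F]_(N, K)) \sum_(b : 'M[F]_(N, K))
     (phi <<col_mx a b>>%MS && (a^T *m b + b^T *m a == S)%R))%N%:R).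
Proof.
apply: (@eq_exp_poly _ _ _ (fun N => \sum_(W | phi W) (exactly W N)%:R)); last first.
  by apply: exp_poly_sum => W _; exact: exactly_poly.
move=> N; rewrite -natr_sum; congr (_%:R); rewrite /exactly [RHS]exchange_big.
apply: eq_bigr => a _; rewrite [RHS]exchange_big; apply: eq_bigr => b _.
rewrite (big_mkcond phi) (bigD1 <<col_mx a b>>%MS) //= eqxx big1 ?addn0 => [|V].
  by case: (phi _).
by rewrite eq_sym => /negbTE ->; rewrite if_same.
Qed.

End RowSpaceCount.

(** * Adjoining hyperbolic planes *)

Section Selection.

Variable F : fieldType.

(** The columns are the standard basis vectors indexed by f, so multiplying by this matrix or its
    transpose extracts columns or rows. *)
Definition selmx a b (f : 'I_a -> 'I_b) : 'M[F]_(b, a) := \matrix_(i, j) (i == f j)%:R.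

Lemma tr_selmx_mul a b c (f : 'I_a -> 'I_b) (M : 'M_(b, c)) :
  (selmx f)^T *m M = rowsub f M.
Proof.
apply/matrixP => i j; rewrite !mxE (bigD1 (f i)) //= big1 ?addr0 => [|k kf].
  by rewrite !mxE eqxx mul1r.
by rewrite !mxE (negbTE kf) mul0r.
Qed.

Lemma mul_selmx a b c (f : 'I_a -> 'I_b) (M : 'M_(c, b)) :
  M *m selmx f = colsub f M.
Proof.
apply/matrixP => i j; rewrite !mxE (bigD1 (f j)) //= big1 ?addr0 => [|k kf].
  by rewrite !mxE eqxx mulr1.
by rewrite !mxE (negbTE kf) mulr0.
Qed.

Lemma selmx_codom a b (f : 'I_a -> 'I_b) : injective f ->
  selmx f *m (selmx f)^T = \matrix_(i, j) ((i == j) && (i \in codom f))%:R.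
Proof.
move=> finj; apply/matrixP => i j; rewrite !mxE.
case: (boolP (i \in codom f)) => [/codomP [k ->]|ni]; last first.
  rewrite andbF big1 // => k _; rewrite !mxE; case: eqP => [E|]; last by rewrite mul0r.
  by rewrite E codom_f in ni.
rewrite andbT (bigD1 k) //= big1 ?addr0 => [|l lk]; first by rewrite !mxE eqxx mul1r eq_sym.
by rewrite !mxE (inj_eq finj) eq_sym (negbTE lk) mul0r.
Qed.

End Selection.

Section Geometry.

Variables (F : finFieldType) (eps : F) (fam : ofamily).

Local Notation d n := (fdim fam n).
Local Notation B n := (Defs.formB eps fam n).

(** The Gram entries as functions of natural numbers, independent of n, so that forms of different
    rank can be compared. *)
Definition gram_entry (i j : nat) : F :=
  match fam with
  | PlusO => ((i./2 == j./2) && (i != j))%:R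
  | MinusO =>
      if ((i < 2) && (j < 2))%N then
        (if i == j then (if i == 0%N then 1 else - eps) else 0)
      else ((i./2 == j./2) && (i != j))%:R
  | OddO =>
      if (i == 0%N) || (j == 0%N) then (i == j)%:R
      else ((i.-1./2 == j.-1./2) && (i != j))%:R
  end.

Lemma formBE n i j : B n i j = gram_entry i j.
Proof. by rewrite mxE. Qed.

Lemma gram_entryC i j : gram_entry i j = gram_entry j i.
Proof.
rewrite /gram_entry; case: fam => /=; rewrite ?[i./2 == _]eq_sym ?[i.-1./2 == _]eq_sym ?[i == j]eq_sym ?[(i == 0%N) || _]orbC ?[(i < 2)%N && _]andbC //.
by case: (j =P i) => [->|].
Qed.

Lemma gram_entry_far n i j : (nmin fam <= n)%N -> (i < d n)%N -> (d n <= j)%N ->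
  gram_entry i j = 0.
Proof.
rewrite /gram_entry /fdim /nmin; case: fam => /= n1 i_lt j_ge.
- rewrite (_ : j == 0%N = false) ?orbF; last by lia.
  case: ifP => i0; first by rewrite (_ : i == j = false) //; lia.
  by rewrite (_ : i.-1./2 == _ = false) //; lia.
- by rewrite (_ : i./2 == _ = false) //; lia.
- rewrite (_ : (j < 2)%N = false) ?andbF; last by lia.
  by rewrite (_ : i./2 == _ = false) //; lia.
Qed.

Lemma gram_entry_new n i j : (nmin fam <= n)%N ->
  gram_entry (d n + i) (d n + j) = ((i./2 == j./2) && (i != j))%:R.
Proof.
rewrite /gram_entry /fdim /nmin; case: fam => /= n1.
- by rewrite !addSn /=; congr (_%:R); lia.
- by congr (_%:R); lia.
- rewrite (_ : (_ < 2)%N = false) /=; last by lia.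
  by congr (_%:R); lia.
Qed.

Lemma formB_tr n : (B n)^T = B n.
Proof. by apply/matrixP => i j; rewrite mxE !formBE gram_entryC. Qed.

Lemma fdim_leq n N : (n <= N)%N -> (d n <= d N)%N.
Proof. by rewrite /fdim; case: fam => /=; lia. Qed.

Lemma fdim_addn n m : d (n + m) = (d n + m.*2)%N.
Proof. by rewrite /fdim; case: fam => /=; lia. Qed.

(** The inclusion of V_n into V_N; the columns of [hypP] and [hypQ] are the two isotropic basis
    vectors of the m hyperbolic planes that follow V_n. *)
Definition inc_mx n N : 'M[F]_(d N, d n) := \matrix_(i, j) ((i : nat) == j)%:R.
Definition hypP n m N : 'M[F]_(d N, m) := \matrix_(i, j) ((i : nat) == d n + j.*2)%:R.
Definition hypQ n m N : 'M[F]_(d N, m) := \matrix_(i, j) ((i : nat) == (d n + j.*2).+1)%:R.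

Section Blocks.

Variables (n m N : nat).
Hypothesis nmN : (n + m <= N)%N.

Let nN : (n <= N)%N. Proof. by lia. Qed.

Let iE (i : 'I_(d n)) : 'I_(d N) := widen_ord (fdim_leq nN) i.

Let iP_subproof (k : 'I_m) : (d n + k.*2 < d N)%N.
Proof. by apply: leq_trans (fdim_leq nmN); rewrite fdim_addn; have := ltn_ord k; lia. Qed.
Let iQ_subproof (k : 'I_m) : ((d n + k.*2).+1 < d N)%N.
Proof. by apply: leq_trans (fdim_leq nmN); rewrite fdim_addn; have := ltn_ord k; lia. Qed.

Let iP k : 'I_(d N) := Ordinal (iP_subproof k).
Let iQ k : 'I_(d N) := Ordinal (iQ_subproof k).

Let iE_inj : injective iE.
Proof. by move=> i j /(congr1 val) /= /val_inj. Qed.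
Let iP_inj : injective iP.
Proof. by move=> i j /(congr1 val) /= H; apply/val_inj => /=; lia. Qed.
Let iQ_inj : injective iQ.
Proof. by move=> i j /(congr1 val) /= H; apply/val_inj => /=; lia. Qed.

Let inc_sel : inc_mx n N = selmx F iE.
Proof. by apply/matrixP => i j; rewrite !mxE. Qed.
Let hypP_sel : hypP n m N = selmx F iP.
Proof. by apply/matrixP => i j; rewrite !mxE. Qed.
Let hypQ_sel : hypQ n m N = selmx F iQ.
Proof. by apply/matrixP => i j; rewrite !mxE. Qed.
Let selE := (inc_sel, hypP_sel, hypQ_sel).

Let sel_block a b (f : 'I_a -> 'I_(d N)) (g : 'I_b -> 'I_(d N)) M :
  (selmx F f)^T *m M *m selmx F g = \matrix_(i, j) M (f i) (g j).
Proof. by rewrite tr_selmx_mul mul_selmx; apply/matrixP => i j; rewrite !mxE. Qed.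

Lemma incT_inc : (inc_mx n N)^T *m inc_mx n N = 1%:M.
Proof.
by rewrite -[_^T]mulmx1 selE sel_block; apply/matrixP => i j; rewrite !mxE.
Qed.

Lemma incT_P : (inc_mx n N)^T *m hypP n m N = 0.
Proof.
rewrite -[_^T]mulmx1 !selE sel_block; apply/matrixP => i j; rewrite !mxE -val_eqE /=.
by have lt := ltn_ord i; rewrite (_ : _ == _ = false) //; lia.
Qed.

Lemma incT_Q : (inc_mx n N)^T *m hypQ n m N = 0.
Proof.
rewrite -[_^T]mulmx1 !selE sel_block; apply/matrixP => i j; rewrite !mxE -val_eqE /=.
by have lt := ltn_ord i; rewrite (_ : _ == _ = false) //; lia.
Qed.

Lemma PT_P : (hypP n m N)^T *m hypP n m N = 1%:M.
Proof.
rewrite -[_^T]mulmx1 !selE sel_block; apply/matrixP => i j; rewrite !mxE -!val_eqE /=.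
by congr (_%:R); lia.
Qed.

Lemma QT_Q : (hypQ n m N)^T *m hypQ n m N = 1%:M.
Proof.
rewrite -[_^T]mulmx1 !selE sel_block; apply/matrixP => i j; rewrite !mxE -!val_eqE /=.
by congr (_%:R); lia.
Qed.

Lemma PT_Q : (hypP n m N)^T *m hypQ n m N = 0.
Proof.
rewrite -[_^T]mulmx1 !selE sel_block; apply/matrixP => i j; rewrite !mxE -!val_eqE /=.
by rewrite (_ : _ == _ = false) //; lia.
Qed.

Lemma inc_P_Q_complete : (n + m = N)%N ->
  inc_mx n N *m (inc_mx n N)^T + hypP n m N *m (hypP n m N)^T
    + hypQ n m N *m (hypQ n m N)^T = 1%:M.
Proof.
move=> eN; rewrite !selE !selmx_codom //; apply/matrixP => i j; rewrite !mxE.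
case: (i =P j) => /= [_|_]; last by rewrite !addr0.
rewrite -!natrD; congr (_%:R).
have iN := ltn_ord i; have dN : d N = (d n + m.*2)%N by rewrite -eN fdim_addn.
case: (ltnP i (d n)) => [i_lt|i_ge].
  rewrite (_ : i \in codom iE); last by apply/codomP; exists (Ordinal i_lt); apply/val_inj.
  have -> : i \in codom iP = false.
    by apply/negbTE/negP => /codomP [k /(congr1 val) /= ik]; lia.
  by apply/eqP; rewrite /= addn0 add1n eqSS eqb0; apply/negP => /codomP [k /(congr1 val) /= ik]; lia.
have -> : i \in codom iE = false.
  by apply/negbTE/negP => /codomP [k /(congr1 val) /= ik]; have := ltn_ord k; lia.
have k_lt : ((i - d n)./2 < m)%N by lia.
case: (boolP (odd (i - d n))) => io.
  have -> : i \in codom iP = false.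
    by apply/negbTE/negP => /codomP [k /(congr1 val) /= ik]; lia.
  rewrite (_ : i \in codom iQ) //.
  by apply/codomP; exists (Ordinal k_lt); apply/val_inj => /=; lia.
rewrite (_ : i \in codom iP); last first.
  by apply/codomP; exists (Ordinal k_lt); apply/val_inj => /=; lia.
by apply/eqP; rewrite /= add0n add1n eqSS eqb0; apply/negP => /codomP [k /(congr1 val) /= ik]; lia.
Qed.

(** This replaces the entrywise case distinction in [embed] by matrix algebra: only g - 1 is
    transported, and it vanishes off V_n. *)
Lemma embedE (g : 'M[F]_(d n)) :
  embed N g = 1%:M + inc_mx n N *m (g - 1%:M) *m (inc_mx n N)^T.
Proof.
apply/matrixP => i j; rewrite mxE [RHS]mxE.
have out (k : 'I_(d N)) l : (d n <= k)%N -> inc_mx n N k l = 0.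
  by move=> nk; rewrite mxE; have lt := ltn_ord l; rewrite (_ : _ == _ = false) //; lia.
case: insubP => [i' _ ii|]; last first.
  rewrite -leqNgt => ni; rewrite -mulmxA [X in _ + X]mxE big1 ?addr0 ?mxE // => k _.
  by rewrite out ?mul0r.
case: insubP => [j' _ jj|]; last first.
  rewrite -leqNgt => nj; rewrite [X in _ + X]mxE big1 ?addr0 ?mxE // => k _.
  by rewrite [_^T _ _]mxE out ?mulr0.
have -> : i = iE i' by apply/val_inj.
have -> : j = iE j' by apply/val_inj.
have := congr1 (fun M : 'M_(d n) => M i' j') (sel_block iE iE (inc_mx n N *m (g - 1%:M) *m (inc_mx n N)^T)).
rewrite -inc_sel !mulmxA incT_inc mul1mx -mulmxA incT_inc mulmx1 [RHS]mxE => <-.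
by rewrite !mxE -!val_eqE /= addrC subrK.
Qed.

Lemma inc_form : (inc_mx n N)^T *m B N *m inc_mx n N = B n.
Proof. by rewrite !selE sel_block; apply/matrixP => i j; rewrite mxE !formBE. Qed.

Hypothesis n_min : (nmin fam <= n)%N.

Lemma inc_form_P : (inc_mx n N)^T *m B N *m hypP n m N = 0.
Proof.
rewrite !selE sel_block; apply/matrixP => i j; rewrite mxE formBE mxE.
by rewrite (@gram_entry_far n) //= ?leq_addr.
Qed.

Lemma inc_form_Q : (inc_mx n N)^T *m B N *m hypQ n m N = 0.
Proof.
rewrite !selE sel_block; apply/matrixP => i j; rewrite mxE formBE mxE.
by rewrite (@gram_entry_far n) //= -addnS leq_addr.
Qed.

Lemma P_form_P : (hypP n m N)^T *m B N *m hypP n m N = 0.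
Proof.
rewrite !selE sel_block; apply/matrixP => i j; rewrite mxE formBE mxE /= gram_entry_new //.
by rewrite (_ : _ && _ = false) //; lia.
Qed.

Lemma Q_form_Q : (hypQ n m N)^T *m B N *m hypQ n m N = 0.
Proof.
rewrite !selE sel_block; apply/matrixP => i j; rewrite mxE formBE mxE /= -!addnS gram_entry_new //.
by rewrite (_ : _ && _ = false) //; lia.
Qed.

Lemma P_form_Q : (hypP n m N)^T *m B N *m hypQ n m N = 1%:M.
Proof.
rewrite !selE sel_block; apply/matrixP => i j; rewrite mxE formBE mxE /= -!addnS gram_entry_new //.
by rewrite -[i == j]val_eqE /=; congr (_%:R); lia.
Qed.

End Blocks.

Lemma inc_comp n N0 N : (n <= N0)%N -> (N0 <= N)%N ->
  inc_mx N0 N *m inc_mx n N0 = inc_mx n N.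
Proof.
move=> nN0 N0N; have nN := leq_trans nN0 N0N.
have -> : inc_mx n N0 = selmx F (widen_ord (fdim_leq nN0)) by apply/matrixP => i j; rewrite !mxE.
by rewrite mul_selmx; apply/matrixP => i j; rewrite !mxE.
Qed.

(** Multiply B_N on both sides by the resolution of the identity into V_n and the two isotropic
    parts; the only surviving blocks are B_n and the two pairings of P with Q. *)
Lemma formB_decomp n m (n_min : (nmin fam <= n)%N) (N := (n + m)%N) :
  B N = inc_mx n N *m B n *m (inc_mx n N)^T
    + (hypP n m N *m (hypQ n m N)^T + hypQ n m N *m (hypP n m N)^T).
Proof.
have nN : (n + m <= N)%N by rewrite leqnn.
set E := inc_mx n N; set P := hypP n m N; set Q := hypQ n m N.
have EP : E^T *m B N *m P = 0 by exact: inc_form_P.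
have EQ : E^T *m B N *m Q = 0 by exact: inc_form_Q.
have trB a b (X : 'M_(d N, a)) (Y : 'M_(d N, b)) : Y^T *m B N *m X = (X^T *m B N *m Y)^T.
  by rewrite !trmx_mul trmxK formB_tr mulmxA.
have PE : P^T *m B N *m E = 0 by rewrite trB EP trmx0.
have QE : Q^T *m B N *m E = 0 by rewrite trB EQ trmx0.
have PQ : P^T *m B N *m Q = 1%:M by exact: P_form_Q.
have QP : Q^T *m B N *m P = 1%:M by rewrite trB PQ trmx1.
have PP : P^T *m B N *m P = 0 by exact: P_form_P.
have QQ : Q^T *m B N *m Q = 0 by exact: Q_form_Q.
have EE : E^T *m B N *m E = B n by exact: inc_form nN.
have C : E *m E^T + P *m P^T + Q *m Q^T = 1%:M by exact: inc_P_Q_complete nN _.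
rewrite -[LHS]mul1mx -[LHS]mulmx1 -C !(mulmxDl, mulmxDr).
have r a b (X : 'M_(d N, a)) (Y : 'M_(d N, b)) :
   X *m X^T *m B N *m (Y *m Y^T) = X *m (X^T *m B N *m Y) *m Y^T by rewrite !mulmxA.
rewrite !r EE EP EQ PE PP PQ QE QP QQ !(mulmx0, mul0mx) !mulmx1.
by rewrite !addr0 !add0r -addrA [Q *m _ + _]addrC.
Qed.

Lemma incT_form n N : (nmin fam <= n)%N -> (n <= N)%N ->
  (inc_mx n N)^T *m B N = B n *m (inc_mx n N)^T.
Proof.
move=> n1 nN; have [m ->] : exists m, N = (n + m)%N by exists (N - n)%N; lia.
have nmN : (n + m <= n + m)%N by [].
rewrite {1}(formB_decomp m n1) mulmxDr !mulmxA (incT_inc nmN) mul1mx mulmxDr !mulmxA.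
by rewrite incT_P // incT_Q // !mul0mx !addr0.
Qed.

Hypothesis eps_neq0 : eps != 0.

Lemma formB_unit n : (nmin fam <= n)%N -> B n \in unitmx.
Proof.
move=> n1; have [m ->] : exists m, n = (nmin fam + m)%N by exists (n - nmin fam)%N; lia.
set k := nmin fam; set N := (k + m)%N.
have kN : (k + m <= N)%N by rewrite leqnn.
(* At the smallest index the form is (1), the empty matrix, or diag(1, -eps); only the last uses
   that eps is nonzero. *)
have Bk : B k \in unitmx.
  rewrite /k /nmin /Defs.formB; case: fam => /=.
  - rewrite unitmxE (_ : \matrix_(_, _) _ = 1%:M) ?det1 ?unitr1 //.
    by apply/matrixP => i j; rewrite !ord1 !mxE.
  - by rewrite unitmxE det_mx00 unitr1.
  rewrite unitmxE (_ : \matrix_(_, _) _ = diag_mx (\row_(j < 2) if (j : nat) == 0%N then 1 else - eps)).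
    by rewrite det_diag !big_ord_recl big_ord0 !mxE /= mulr1 mul1r unitfE oppr_eq0.
  by apply/matrixP => i j; rewrite !mxE !ltn_ord /= -val_eqE; case: eqP => // ->; case: eqP.
pose E := inc_mx k N; pose P := hypP k m N; pose Q := hypQ k m N.
(* The explicit inverse: invert B_k on the smallest space and keep the hyperbolic part, which is its
   own inverse. *)
suff /mulmx1_unit [] : B N *m (E *m invmx (B k) *m E^T + (P *m Q^T + Q *m P^T)) = 1%:M by [].
rewrite formB_decomp // -/N -/E -/P -/Q.
have EE : E^T *m E = 1%:M by exact: incT_inc kN.
have EP : E^T *m P = 0 by exact: incT_P kN.
have EQ : E^T *m Q = 0 by exact: incT_Q kN.
have PP : P^T *m P = 1%:M by exact: PT_P kN.
have QQ : Q^T *m Q = 1%:M by exact: QT_Q kN.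
have PQ : P^T *m Q = 0 by exact: PT_Q kN.
have PE : P^T *m E = 0 by rewrite -[LHS]trmxK trmx_mul trmxK EP trmx0.
have QE : Q^T *m E = 0 by rewrite -[LHS]trmxK trmx_mul trmxK EQ trmx0.
have QP : Q^T *m P = 0 by rewrite -[LHS]trmxK trmx_mul trmxK PQ trmx0.
rewrite !(mulmxDl, mulmxDr) !mulmxA.
have r a b c (X : 'M_(d N, a)) (Y : 'M_(d N, b)) (Z : 'M_(b, c)) (W : 'M_(d N, a)) :
  X *m W^T *m Y *m Z = X *m (W^T *m Y) *m Z by rewrite -!mulmxA.
rewrite !r EE EP EQ PE PP PQ QE QP QQ !(mulmx0, mul0mx) !mulmx1 mulmxK //.
by rewrite !addr0 !add0r -[RHS](inc_P_Q_complete kN) // !addrA.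
Qed.

End Geometry.

(** * The Wall form and stable Witt theorem *)

Lemma trmxD (V : nmodType) m n (X Y : 'M[V]_(m, n)) : (X + Y)^T = X^T + Y^T.
Proof. by apply/matrixP => i j; rewrite !mxE. Qed.

Lemma trmxN (V : zmodType) m n (X : 'M[V]_(m, n)) : (- X)^T = - X^T.
Proof. by apply/matrixP => i j; rewrite !mxE. Qed.

Lemma trmxZ (R : pzRingType) a m n (X : 'M[R]_(m, n)) : (a *: X)^T = a *: X^T.
Proof. by apply/matrixP => i j; rewrite !mxE. Qed.

Section Wall.

Variables (F : finFieldType) (eps : F) (fam : ofamily).
Hypothesis eps_neq0 : eps != 0.

Local Notation d n := (fdim fam n).
Local Notation B n := (Defs.formB eps fam n).
Local Notation inc n N := (inc_mx F fam n N).

Lemma col_free_inj a s b (I : 'M[F]_(a, s)) (X Y : 'M_(s, b)) :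
  row_free I^T -> I *m X = I *m Y -> X = Y.
Proof.
move=> fI E; apply: trmx_inj; apply: (row_free_inj fI).
by rewrite -!trmx_mul E.
Qed.

Lemma col_free_mulr a s b (I : 'M[F]_(a, s)) (X : 'M_(b, a)) :
  row_free (X *m I)^T -> row_free I^T.
Proof.
rewrite /row_free !mxrank_tr => /eqP r; rewrite eqn_leq rank_leq_col -{1}r.
exact: mxrankM_maxr.
Qed.

Lemma col_free_mul a s b (I : 'M[F]_(a, s)) (X : 'M_(b, a)) :
  row_free X^T -> row_free I^T -> row_free (X *m I)^T.
Proof. by move=> fX fI; rewrite trmx_mul /row_free mxrankMfree. Qed.

Lemma inG_unit n (c : 'M_(d n)) : (nmin fam <= n)%N -> inG eps c -> c \in unitmx.
Proof.
move=> n1 /eqP cB; have Bu := formB_unit eps_neq0 n1.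
suff /mulmx1_unit [] : invmx (B n) *m c^T *m B n *m c = 1%:M by [].
by rewrite -!mulmxA [c^T *m _]mulmxA cB mulVmx.
Qed.

Lemma inG_mul n (b c : 'M_(d n)) : inG eps b -> inG eps c -> inG eps (b *m c).
Proof.
move=> /eqP bB /eqP cB; apply/eqP.
by rewrite trmx_mul -!mulmxA [b^T *m _]mulmxA [b^T *m _ *m _]mulmxA bB mulmxA.
Qed.

Lemma inG_inv n (c : 'M_(d n)) : c \in unitmx -> inG eps c -> inG eps (invmx c).
Proof.
move=> cu /eqP cB; apply/eqP.
by rewrite -{1}cB trmx_inv !mulmxA mulVmx ?unitmx_tr // mul1mx mulmxK.
Qed.

(** For injective I and invertible A, the columns of I form a basis of the image of g - 1, and A is,
    up to transposition, the inverse of the matrix of Wall's form in that basis. *)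
Definition wall n s (A : 'M[F]_s) (I : 'M[F]_(d n, s)) : 'M[F]_(d n) :=
  1%:M + I *m A *m I^T *m B n.

Definition wall_type n (g : 'M[F]_(d n)) s (A : 'M[F]_s) : Prop :=
  exists2 I : 'M[F]_(d n, s), row_free I^T & g = wall A I.

Lemma wall_isometry n s (A : 'M_s) (I : 'M_(d n, s)) : (nmin fam <= n)%N ->
  row_free I^T ->
  inG eps (wall A I) = (A + A^T + A^T *m (I^T *m B n *m I) *m A == 0).
Proof.
move=> n1 fI; have Bu := formB_unit eps_neq0 n1.
have E : (wall A I)^T *m B n *m wall A I =
   B n + B n *m I *m (A + A^T + A^T *m (I^T *m B n *m I) *m A) *m I^T *m B n.
  rewrite /wall trmxD trmx1 !trmx_mul trmxK formB_tr.
  rewrite !(mulmxDl, mulmxDr) !mulmxA !mul1mx !mulmx1 -!addrA; congr (_ + _).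
  by rewrite [RHS]addrCA.
rewrite /inG E; apply/eqP/eqP => [|->]; last by rewrite mulmx0 !mul0mx addr0.
rewrite -[RHS]addr0 => /addrI H.
have BI : row_free (B n *m I)^T by rewrite col_free_mul // row_free_unit unitmx_tr.
apply: (col_free_inj BI); rewrite mulmx0.
apply: (row_free_inj fI); rewrite mul0mx.
by apply: (row_free_inj (_ : row_free (B n))); rewrite ?mul0mx // row_free_unit.
Qed.

(** The solution S of A + A^T + A^T S A = 0: for an isometry, A determines the Gram matrix of I. *)
Definition wall_gram s (A : 'M[F]_s) : 'M[F]_s := - (invmx A^T *m (A + A^T) *m invmx A).

Lemma wall_isometry_gram n s (A : 'M_s) (I : 'M_(d n, s)) : (nmin fam <= n)%N ->
  A \in unitmx -> row_free I^T ->
  inG eps (wall A I) = (I^T *m B n *m I == wall_gram A).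
Proof.
move=> n1 Au fI; rewrite wall_isometry //; set S := _ *m I.
have ATu : A^T \in unitmx by rewrite unitmx_tr.
rewrite addrC addr_eq0 /wall_gram -mulNmx -mulmxN; apply/eqP/eqP => [<-|->].
  by rewrite (mulmxA (invmx _)) mulmxK // mulKmx.
by rewrite (mulmxA A^T) mulmxKV // mulKVmx.
Qed.

(** Factor g - 1 = I R with both factors of full rank. The isometry condition forces I^T B = C R
    with C invertible, so A is the inverse of C. *)
Lemma wall_exists n (g : 'M_(d n)) : (nmin fam <= n)%N -> inG eps g ->
  exists2 A : 'M[F]_(\rank (g - 1%:M)), A \in unitmx & wall_type g A.
Proof.
move=> n1 /eqP gB; have Bu := formB_unit eps_neq0 n1.
set D := g - 1%:M; set s := \rank D.
have gD : g = 1%:M + D by rewrite addrC subrK.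
have [I [R [DE fI fR]]] : exists I R, [/\ D = I *m R, row_free (I : 'M_(d n, s))^T & row_free R].
  exists (col_base D), (row_base D); split; rewrite ?mulmx_base ?row_base_free //.
  by rewrite /row_free mxrank_tr; exact: col_base_full.
clearbody s.
have BD : B n *m D = - (D^T *m B n *m g).
  apply/eqP; rewrite -addr_eq0; apply/eqP; move: gB.
  rewrite {1}gD trmxD trmx1 mulmxDl mul1mx mulmxDl {1}gD mulmxDr mulmx1.
  by rewrite -[X in _ = X]addr0 -addrA => /addrI.
have [Z ZR] : exists Z, Z *m R^T = 1%:M.
  have /row_freeP [Z RZ] := fR; exists Z^T.
  by rewrite -trmx_mul RZ trmx1.
(* Transpose [BD] and cancel R^T with its left inverse Z. *)
have key : I^T *m B n = - (Z *m g^T *m B n *m I) *m R.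
  have := congr1 trmx BD; rewrite linearN /= !trmx_mul trmxK formB_tr DE trmx_mul => H.
  have := congr1 (mulmx Z) H; rewrite !mulmxA ZR mul1mx => ->.
  by rewrite mulmxN mulNmx !mulmxA.
set C := - _ in key.
have fIB : row_free (I^T *m B n).
  by rewrite /row_free mxrankMfree // row_free_unit.
have Cu : C \in unitmx.
  by rewrite -row_free_unit; move: fIB; rewrite key /row_free mxrankMfree.
exists (invmx C); first by rewrite unitmx_inv.
by exists I => //; rewrite /wall -mulmxA key !mulmxA mulmxKV // -DE.
Qed.

Lemma wall_inj n s s' (A : 'M_s) (A' : 'M_s') (I : 'M_(d n, s)) (J : 'M_(d n, s')) :
  (nmin fam <= n)%N -> wall A I = wall A' J -> I *m A *m I^T = J *m A' *m J^T.
Proof.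
move=> n1 /addrI E; apply: (row_free_inj (_ : row_free (B n))); rewrite ?row_free_unit //.
exact: formB_unit.
Qed.

(** Since J^T has a right inverse and A' is invertible, the equation puts the columns of J in the
    span of I. Thus A is unique up to congruence, and k describes the change of frame. *)
Lemma congruence_factor a s s' (A : 'M[F]_s) (A' : 'M_s') (I : 'M_(a, s)) (J : 'M_(a, s')) :
  A' \in unitmx -> row_free I^T -> row_free J^T ->
  I *m A *m I^T = J *m A' *m J^T ->
  exists2 k : 'M_(s, s'), J = I *m k & A = k *m A' *m k^T.
Proof.
move=> A'u fI fJ E; have /row_freeP [Y JY] := fJ.
exists (A *m I^T *m Y *m invmx A') => [|].
  by rewrite !mulmxA E -[_ *m Y]mulmxA JY mulmx1 mulmxK.
set k := _ *m invmx A'.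
have Jk : J = I *m k by rewrite /k !mulmxA E -[_ *m Y]mulmxA JY mulmx1 mulmxK.
apply: (col_free_inj fI); apply: (row_free_inj fI).
by rewrite E Jk trmx_mul !mulmxA.
Qed.

Lemma embed_wall n N s (A : 'M_s) (I : 'M_(d n, s)) :
  (nmin fam <= n)%N -> (n <= N)%N -> embed N (wall A I) = wall A (inc n N *m I).
Proof.
move=> n1 nN; have n0N : (n + 0 <= N)%N by rewrite addn0.
rewrite (embedE n0N) /wall; congr (_ + _); rewrite [1%:M + _]addrC addrK.
by rewrite trmx_mul -!mulmxA incT_form.
Qed.

Lemma inc_free n N s (I : 'M_(d n, s)) : (n <= N)%N -> row_free I^T -> row_free (inc n N *m I)^T.
Proof.
move=> nN fI; apply: col_free_mul fI; have n0N : (n + 0 <= N)%N by rewrite addn0.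
apply/row_freeP; exists (inc n N); exact: incT_inc n0N.
Qed.

Lemma inc_gram n N s (I : 'M_(d n, s)) : (n <= N)%N ->
  (inc n N *m I)^T *m B N *m (inc n N *m I) = I^T *m B n *m I.
Proof.
move=> nN; have n0N : (n + 0 <= N)%N by rewrite addn0.
by rewrite -(inc_form eps _ n0N) trmx_mul !mulmxA.
Qed.

Lemma conj_wall n s (A : 'M_s) (I : 'M_(d n, s)) (c : 'M_(d n)) :
  inG eps c -> c \in unitmx -> invmx c *m wall A I *m c = wall A (invmx c *m I).
Proof.
move=> /eqP cB cu; rewrite /wall mulmxDr mulmxDl mulmx1 mulVmx //; congr (_ + _).
rewrite trmx_mul -!mulmxA; do 3! congr (_ *m _).
by rewrite -[in RHS]cB -!mulmxA trmx_inv mulKmx // unitmx_tr.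
Qed.

Lemma wall_type_embed n N (g : 'M_(d n)) s (A : 'M_s) :
  (nmin fam <= n)%N -> (n <= N)%N -> wall_type g A -> wall_type (embed N g) A.
Proof.
by move=> n1 nN [I fI ->]; exists (inc n N *m I); rewrite ?inc_free // embed_wall.
Qed.

Lemma wall_type_conj n (c g : 'M_(d n)) s (A : 'M_s) :
  inG eps c -> c \in unitmx -> wall_type g A -> wall_type (invmx c *m g *m c) A.
Proof.
move=> cG cu [I fI ->]; exists (invmx c *m I); last by rewrite conj_wall.
by rewrite col_free_mul // row_free_unit unitmx_tr unitmx_inv.
Qed.

Lemma wall_type_unembed n N (g : 'M_(d n)) s (A : 'M_s) : A \in unitmx ->
  (nmin fam <= n)%N -> (n <= N)%N -> inG eps g -> wall_type (embed N g) A -> wall_type g A.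
Proof.
move=> Au n1 nN gG [J fJ].
have [A' A'u [I fI ->]] := wall_exists n1 gG.
(* The frame J has columns in the span of the included frame of g, hence it comes from V_n. *)
rewrite embed_wall // => /(wall_inj (leq_trans n1 nN)) E.
have [k Jk A'k] := congruence_factor Au (inc_free nN fI) fJ E.
exists (I *m k); first by apply: (@col_free_mulr _ _ _ _ (inc n N)); rewrite mulmxA -Jk.
by rewrite /wall A'k trmx_mul !mulmxA.
Qed.

Lemma sametype_wall_type (a b : elt F fam) s (A : 'M_s) : A \in unitmx ->
  (nmin fam <= projT1 a)%N -> (nmin fam <= projT1 b)%N -> inG eps (projT2 b) ->
  sametype eps a b -> wall_type (projT2 a) A -> wall_type (projT2 b) A.
Proof.
move=> Au a1 b1 bG [N [aN bN [c [cG cu E]]]] Ha.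
apply: (wall_type_unembed Au b1 bN bG); rewrite E.
exact/wall_type_conj/wall_type_embed.
Qed.

(** * Siegel transformations and the stable Witt theorem *)

Hypothesis two_neq0 : 2%:R != 0 :> F.

Lemma tr_gram n a b (X : 'M[F]_(d n, a)) (Y : 'M[F]_(d n, b)) :
  (X^T *m B n *m Y)^T = Y^T *m B n *m X.
Proof. by rewrite !trmx_mul trmxK formB_tr mulmxA. Qed.

Lemma half_add m n (X : 'M[F]_(m, n)) : 2%:R^-1 *: X + 2%:R^-1 *: X = X.
Proof.
rewrite -scalerDl (_ : _ + _ = 1) ?scale1r //.
by have -> : 2%:R^-1 + 2%:R^-1 = 2%:R * 2%:R^-1 :> F; [ring | rewrite mulfV].
Qed.

(** The Siegel (or Eichler) transformation of a totally isotropic frame P and a frame Y orthogonal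
    to it. *)
Definition siegel n s (P Y : 'M[F]_(d n, s)) : 'M[F]_(d n) :=
  1%:M + (P *m Y^T - Y *m P^T - 2%:R^-1 *: (P *m (Y^T *m B n *m Y) *m P^T)) *m B n.

(** The map 1 + X B is an isometry once X + X^T + X^T B X = 0. The skew part of X drops out of X +
    X^T, and the quadratic term with factor one half cancels X^T B X = P (Y^T B Y) P^T. *)
Lemma siegel_inG n s (P Y : 'M_(d n, s)) :
  P^T *m B n *m P = 0 -> P^T *m B n *m Y = 0 -> inG eps (siegel P Y).
Proof.
move=> PP PY; have YP : Y^T *m B n *m P = 0.
  by rewrite -tr_gram PY trmx0.
set G := Y^T *m B n *m Y; have GT : G^T = G by rewrite tr_gram.
pose X := P *m Y^T - Y *m P^T - 2%:R^-1 *: (P *m G *m P^T).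
have XT : X^T = Y *m P^T - P *m Y^T - 2%:R^-1 *: (P *m G *m P^T).
  by rewrite /X !trmxD !trmxN trmxZ !trmx_mul !trmxK formB_tr /G !mulmxA.
have XBX : X^T *m B n *m X = P *m G *m P^T.
  rewrite XT /X !(mulmxDl, mulmxDr, mulmxN, mulNmx) -!scalemxAl -!scalemxAr !mulmxA.
  have r a b (U : 'M_(a, s)) (X1 Y1 : 'M_(d n, s)) (V : 'M_(s, b)) :
    U *m X1^T *m B n *m Y1 *m V = U *m (X1^T *m B n *m Y1) *m V by rewrite !mulmxA.
  rewrite !r PP PY YP -/G !(mulmx0, mul0mx, scaler0, oppr0, addr0, add0r).
  by rewrite ?opprK.
apply/eqP; rewrite /siegel -/G -/X trmxD trmx1 trmx_mul formB_tr.
have XE : X = P *m Y^T - Y *m P^T - 2%:R^-1 *: (P *m G *m P^T) by [].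
clearbody X.
have -> : (1%:M + B n *m X^T) *m B n *m (1%:M + X *m B n) =
    B n + B n *m (X + X^T + X^T *m B n *m X) *m B n.
  rewrite !(mulmxDl, mulmxDr) !mul1mx !mulmx1 !mulmxA -!addrA; congr (_ + _).
  by rewrite addrCA.
rewrite XBX XT (_ : X + _ + _ = 0) ?mulmx0 ?mul0mx ?addr0 // XE.
set U := P *m Y^T; set V := Y *m P^T; set W := P *m G *m P^T.
rewrite -{3}(half_add W); move: (2%:R^-1 *: W) => {}W; apply/matrixP => i j; rewrite !mxE; ring.
Qed.

(** The first transformation sends J to J + P. The second then cancels J and adds Q times half the
    Gram matrix of J. *)
Lemma siegel_frame n s (P Q Y J : 'M_(d n, s)) :
  Q^T *m B n *m P = 1%:M -> P^T *m B n *m J = 0 -> Q^T *m B n *m J = 0 ->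
  Y^T *m B n *m J = 1%:M ->
  siegel Q J *m siegel P Y *m J = P + 2%:R^-1 *: (Q *m (J^T *m B n *m J)).
Proof.
move=> QP PJ QJ YJ; have JP : J^T *m B n *m P = 0 by rewrite -tr_gram PJ trmx0.
have app (P' Y' X : 'M_(d n, s)) : siegel P' Y' *m X = X + (P' *m (Y'^T *m B n *m X)
   - Y' *m (P'^T *m B n *m X) - 2%:R^-1 *: (P' *m (Y'^T *m B n *m Y') *m (P'^T *m B n *m X))).
  by rewrite /siegel !mulmxDl mul1mx !mulNmx -!scalemxAl !mulmxA.
rewrite -mulmxA (app P Y J) YJ PJ !mulmx0 mulmx1 scaler0 !subr0 app !mulmxDr.
rewrite JP QJ QP !mulmx0 !addr0 !add0r !mulmx1.
set S := Q *m _; rewrite -{1}(half_add S).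
move: (2%:R^-1 *: S) => {}S; apply/matrixP => i j; rewrite !mxE; ring.
Qed.

(* Two Siegel transformations move any frame I of V_n0 to a standard position that depends
   only on its Gram matrix: this is Witt's theorem after stabilisation. *)
Lemma stable_witt_standard n0 N s (I : 'M_(d n0, s)) :
  (nmin fam <= n0)%N -> (n0 + s <= N)%N -> row_free I^T ->
  exists2 c : 'M_(d N), inG eps c &
    c *m (inc n0 N *m I) =
      hypP F fam n0 s N + 2%:R^-1 *: (hypQ F fam n0 s N *m (I^T *m B n0 *m I)).
Proof.
move=> n1 n0N fI; have nN : (n0 <= N)%N by lia.
have /row_freeP [L IL] := fI.
set E := inc n0 N; set P := hypP _ _ _ _ _; set Q := hypQ _ _ _ _ _.
have EP : E^T *m B N *m P = 0 by exact: inc_form_P.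
have EQ : E^T *m B N *m Q = 0 by exact: inc_form_Q.
have PE : P^T *m B N *m E = 0.
  by rewrite -tr_gram EP trmx0.
have QE : Q^T *m B N *m E = 0.
  by rewrite -tr_gram EQ trmx0.
have PQ : P^T *m B N *m Q = 1%:M by exact: P_form_Q.
have QP : Q^T *m B N *m P = 1%:M.
  by rewrite -tr_gram PQ trmx1.
have PP : P^T *m B N *m P = 0 by exact: P_form_P.
have QQ : Q^T *m B N *m Q = 0 by exact: Q_form_Q.
have Bu := formB_unit eps_neq0 n1.
(* Y is a frame dual to J for the form, built from a right inverse L of I^T. *)
pose Y := E *m invmx (B n0) *m L; pose J := E *m I.
have YJ : Y^T *m B N *m J = 1%:M.
  rewrite /Y /J !trmx_mul trmx_inv formB_tr !mulmxA -[_ *m E]mulmxA -!mulmxA.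
  rewrite (mulmxA E^T) [E^T *m B N *m _]mulmxA (inc_form eps _ n0N) mulKmx //.
  by rewrite -[L^T *m I]trmxK trmx_mul trmxK IL trmx1.
have JJ : J^T *m B N *m J = I^T *m B n0 *m I by exact: inc_gram.
have PJ : P^T *m B N *m J = 0 by rewrite /J mulmxA PE mul0mx.
have QJ : Q^T *m B N *m J = 0 by rewrite /J mulmxA QE mul0mx.
have PY : P^T *m B N *m Y = 0 by rewrite /Y !mulmxA PE !mul0mx.
exists (siegel Q J *m siegel P Y); first by rewrite inG_mul ?siegel_inG.
by rewrite -JJ; apply: siegel_frame.
Qed.

(** Both frames have Gram matrix [wall_gram A], so both can be moved to the same standard position.
    Conjugacy at every large N, not just at one, is needed later to compare polynomials. *)
Lemma wall_type_conj_stable (a b : elt F fam) s (A : 'M_s) : A \in unitmx ->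
  (nmin fam <= projT1 a)%N -> (nmin fam <= projT1 b)%N ->
  inG eps (projT2 a) -> inG eps (projT2 b) ->
  wall_type (projT2 a) A -> wall_type (projT2 b) A ->
  exists N0, forall N, (N0 <= N)%N ->
    [/\ (projT1 a <= N)%N, (projT1 b <= N)%N &
    exists c : 'M_(d N), [/\ inG eps c, c \in unitmx &
      embed N (projT2 b) = invmx c *m embed N (projT2 a) *m c]].
Proof.
case: a b => [n g] [n' g'] /= Au n1 n1' gG gG' [I fI gE] [J fJ gE'].
have gram_wall k (h : 'M_(d k)) (X : 'M_(d k, s)) : (nmin fam <= k)%N -> row_free X^T ->
    h = wall A X -> inG eps h -> X^T *m B k *m X = wall_gram A.
  by move=> k1 fX ->; rewrite wall_isometry_gram // => /eqP.
pose n0 := maxn n n'; exists (n0 + s)%N => N N0N.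
have nn0 : (n <= n0)%N by exact: leq_maxl.
have nn0' : (n' <= n0)%N by exact: leq_maxr.
have n0N : (n0 <= N)%N by lia.
have n01 : (nmin fam <= n0)%N by lia.
have nN : (n <= N)%N by lia.
have nN' : (n' <= N)%N by lia.
split => //.
have [c1 c1G E1] := stable_witt_standard n01 N0N (inc_free nn0 fI).
have [c2 c2G E2] := stable_witt_standard n01 N0N (inc_free nn0' fJ).
have N1 : (nmin fam <= N)%N by lia.
have c1u := inG_unit N1 c1G; have c2u := inG_unit N1 c2G.
move: E1 E2; rewrite !inc_gram // (gram_wall _ _ _ n1 fI gE gG) (gram_wall _ _ _ n1' fJ gE' gG').
rewrite !(mulmxA (inc_mx _ _ n0 N)) !inc_comp // => <- E12.
have cG : inG eps (invmx c1 *m c2) by rewrite inG_mul ?inG_inv.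
have cu : invmx c1 *m c2 \in unitmx by rewrite unitmx_mul unitmx_inv c1u.
exists (invmx c1 *m c2); split => //.
rewrite gE gE' !embed_wall // conj_wall //; congr (wall A _).
apply: (canRL (mulKmx cu)); rewrite -!mulmxA; apply: (canLR (mulKmx c1u)).
by rewrite E12.
Qed.

Lemma wall_type_sametype (a b : elt F fam) s (A : 'M_s) : A \in unitmx ->
  (nmin fam <= projT1 a)%N -> (nmin fam <= projT1 b)%N ->
  inG eps (projT2 a) -> inG eps (projT2 b) ->
  wall_type (projT2 a) A -> wall_type (projT2 b) A -> sametype eps a b.
Proof.
move=> Au a1 b1 aG bG Ha Hb.
have [N /(_ N (leqnn N)) H] := wall_type_conj_stable Au a1 b1 aG bG Ha Hb.
by exists N.
Qed.

End Wall.

(** * The structure constants as functions of m *)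

Section Count.

Variables (F : finFieldType) (eps : F) (fam : ofamily).
Hypothesis eps_neq0 : eps != 0.
Hypothesis two_neq0 : 2%:R != 0 :> F.

Local Notation d n := (fdim fam n).
Local Notation B n := (Defs.formB eps fam n).
Local Notation inc n N := (inc_mx F fam n N).

Definition frame n s (A : 'M[F]_s) (I : 'M[F]_(d n, s)) : bool :=
  row_free I^T && (I^T *m B n *m I == wall_gram A).

(** The number of frames that represent one and the same isometry. *)
Definition stab_card s (A : 'M[F]_s) : nat := #|[set k : 'M[F]_s | k *m A *m k^T == A]|.

Lemma stab_card_gt0 s (A : 'M_s) : (0 < stab_card A)%N.
Proof. by apply/card_gt0P; exists 1%:M; rewrite inE mul1mx trmx1 mulmx1. Qed.

Section OneType.

Variables (mu : elt F fam) (s : nat) (A : 'M[F]_s).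
Hypotheses (mu_min : (nmin fam <= projT1 mu)%N) (muG : inG eps (projT2 mu)).
Hypotheses (Au : A \in unitmx) (muA : wall_type eps (projT2 mu) A).

Lemma hasTypeP n (g : 'M_(d n)) : (nmin fam <= n)%N ->
  hasType eps g mu <-> exists2 I, frame A I & g = wall eps A I.
Proof.
move=> n1; split=> [/andP [gG /asboolP gmu]|[I /andP [fI SI] gE]].
  have [N [gN muN [c [cG cu E]]]] := gmu.
  have mug : sametype eps mu (existT _ n g).
    exists N; split => //; exists (invmx c); split; rewrite ?inG_inv ?unitmx_inv //.
    by rewrite invmxK E !mulmxA mulmxV // mul1mx mulmxK.
  have [I fI gE] : wall_type eps g A.
    exact: (sametype_wall_type eps_neq0 Au mu_min _ _ mug muA).
  by exists I => //; rewrite /frame fI -wall_isometry_gram // -gE.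
have gG : inG eps g by rewrite gE wall_isometry_gram.
rewrite /hasType gG; apply/asboolP.
apply: (wall_type_sametype eps_neq0 two_neq0 Au) => //.
by exists I.
Qed.

Lemma frame_count n (g : 'M_(d n)) : (nmin fam <= n)%N ->
  (\sum_(I : 'M_(d n, s)) (frame A I && (wall eps A I == g)) = hasType eps g mu * stab_card A)%N.
Proof.
move=> n1; case: (boolP (hasType eps g mu)) => [/(hasTypeP _ n1) [I0 /andP [f0 S0] gE]|ng]; last first.
  rewrite mul0n big1 // => I _; apply/eqP; rewrite eqb0; apply: contra ng => /andP [fI /eqP gE].
  by apply/(hasTypeP _ n1); exists I.
(* The frames of g are exactly the I0 k with k in the stabiliser of A, each arising once. *)
have I0_inj : injective (mulmx I0 : 'M_s -> _) by move=> k l; exact: col_free_inj.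
rewrite mul1n /stab_card -(card_imset _ I0_inj) -sum1_card [RHS]big_mkcond /=.
apply: eq_bigr => I _; suff -> : (frame A I && (wall eps A I == g)) = (I \in mulmx I0 @: [set k | k *m A *m k^T == A]) by case: ifP.
apply/andP/imsetP => [[/andP [fI _] /eqP]|[k]].
  rewrite gE => /esym /(wall_inj eps_neq0 n1) E.
  have [k Ik Ak] := congruence_factor Au f0 fI E.
  by exists k; rewrite // inE -Ak.
rewrite inE => /eqP Ak ->.
have w : wall eps A (I0 *m k) = g by rewrite gE /wall trmx_mul -{2}Ak !mulmxA.
have ku : k \in unitmx.
  suff /mulmx1_unit [] : k *m (A *m k^T *m invmx A) = 1%:M by [].
  by rewrite !mulmxA Ak mulmxV.
have fk : row_free (I0 *m k)^T by rewrite col_free_mul // row_free_unit unitmx_tr.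
by rewrite w /frame fk -wall_isometry_gram // w gE wall_isometry_gram.
Qed.

End OneType.

(** * Factorisations of an element, counted by pairs of frames *)

Section TwoTypes.

Variables (mu nu : elt F fam) (s t : nat) (A : 'M[F]_s) (A' : 'M[F]_t).
Hypotheses (mu_min : (nmin fam <= projT1 mu)%N) (muG : inG eps (projT2 mu)).
Hypotheses (nu_min : (nmin fam <= projT1 nu)%N) (nuG : inG eps (projT2 nu)).
Hypotheses (Au : A \in unitmx) (muA : wall_type eps (projT2 mu) A).
Hypotheses (Au' : A' \in unitmx) (nuA : wall_type eps (projT2 nu) A').

Definition frame_pair n (h : 'M[F]_(d n)) (I : 'M[F]_(d n, s)) (J : 'M[F]_(d n, t)) : bool :=
  [&& frame A I, frame A' J & wall eps A I *m wall eps A' J == h].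

Lemma prodCoef_frames n (h : 'M_(d n)) : (nmin fam <= n)%N ->
  (stab_card A * stab_card A')%N%:R * prodCoef eps mu nu h =
    (\sum_(I : 'M_(d n, s)) \sum_(J : 'M_(d n, t)) frame_pair h I J)%N%:R.
Proof.
move=> n1; have -> : prodCoef eps mu nu h =
    (\sum_(x : 'M_(d n)) \sum_(y : 'M_(d n) | x *m y == h) (hasType eps x mu && hasType eps y nu))%N%:R.
  by rewrite natr_sum; apply: eq_bigr => x _; rewrite natr_sum.
rewrite -natrM; congr (_%:R).
(* A pair of frames determines both factors x and y; writing it as a sum over them lets the sums
   over I and J separate. *)
have E I J : (frame_pair h I J : nat) = (\sum_(x : 'M_(d n)) \sum_(y : 'M_(d n) | x *m y == h)
    (frame A I && (wall eps A I == x)) * (frame A' J && (wall eps A' J == y)))%N.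
  rewrite (bigD1 (wall eps A I)) //= [X in (_ + X)%N]big1 ?addn0 => [|x nx]; last first.
    by rewrite big1 // => y _; rewrite eq_sym (negbTE nx) andbF.
  rewrite big_mkcond (bigD1 (wall eps A' J)) //= [X in (_ + X)%N]big1 ?addn0 => [|y ny]; last first.
    by rewrite [wall _ _ _ == y]eq_sym (negbTE ny) andbF muln0 if_same.
  rewrite /frame_pair !eqxx !andbT mulnb andbA andbC.
  by case: (_ == h).
under [RHS]eq_bigr => I _ do (under eq_bigr => J _ do rewrite E).
rewrite big_distrr /=; under [RHS]eq_bigr => I _ do rewrite exchange_big /=.
rewrite [RHS]exchange_big /=; apply: eq_bigr => x _.
rewrite big_distrr /=; under [RHS]eq_bigr => I _ do rewrite exchange_big /=.
rewrite [RHS]exchange_big /=; apply: eq_bigr => y _.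
under [RHS]eq_bigr => I _ do rewrite -big_distrr /=.
rewrite -big_distrl /= (frame_count mu_min muG) // (frame_count nu_min nuG) //.
by rewrite -mulnb mulnACA; congr (_ * _)%N; rewrite mulnC.
Qed.

(** The matrix T with (1 + I A I^T B)(1 + J A' J^T B) = 1 + X T X^T B, where X = [I | J] and C = I^T
    B J. *)
Let tr_form (C : 'M[F]_(s, t)) : 'M[F]_(s + t) := block_mx A (A *m C *m A') 0 A'.

Let big_frames N (f : 'M[F]_(d N, s) -> 'M[F]_(d N, t) -> nat) :
  (\sum_I \sum_J f I J = \sum_(X : 'M_(d N, s + t)) f (lsubmx X) (rsubmx X))%N.
Proof.
rewrite pair_bigA /= (reindex (fun X : 'M_(d N, s + t) => (lsubmx X, rsubmx X))) //.
exists (fun p => row_mx p.1 p.2) => [X|[I J]] _ /=; first by rewrite hsubmxK.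
by rewrite row_mxKl row_mxKr.
Qed.

Let gram_row_mx a (M : 'M[F]_a) (I : 'M_(a, s)) (J : 'M_(a, t)) :
  (row_mx I J)^T *m M *m row_mx I J =
    block_mx (I^T *m M *m I) (I^T *m M *m J) (J^T *m M *m I) (J^T *m M *m J).
Proof. by rewrite tr_row_mx mul_col_mx mul_col_row. Qed.

Let wall_mul N (X : 'M_(d N, s + t)) :
  wall eps A (lsubmx X) *m wall eps A' (rsubmx X) =
  1%:M + X *m tr_form (ursubmx (X^T *m B N *m X)) *m X^T *m B N.
Proof.
rewrite -[X]hsubmxK; move: (lsubmx X) (rsubmx X) => I J.
rewrite gram_row_mx block_mxKur row_mxKl row_mxKr.
rewrite tr_row_mx /tr_form mul_row_block mulmx0 addr0 mul_row_col.
rewrite /wall !(mulmxDl, mulmxDr) !mul1mx !mulmx1 !mulmxA -!addrA; congr (_ + _).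
by rewrite [RHS]addrA [RHS]addrC.
Qed.

(** * Splitting a pair of frames into old and hyperbolic coordinates *)

Section OneElement.

Variables (n : nat) (h : 'M[F]_(d n)).
Hypothesis n_min : (nmin fam <= n)%N.

(** All conditions apart from the Gram condition: both frames are injective, and the product is h on
    V_n and trivial on the new planes. The number w of rows is left free so that W may be the
    hyperbolic part or its canonical row space matrix. *)
Let good w (C : 'M[F]_(s, t)) (X0 : 'M[F]_(d n, s + t)) (W : 'M[F]_(w, s + t)) : bool :=
  [&& (\rank (lsubmx (col_mx X0 W)) == s) && (\rank (rsubmx (col_mx X0 W)) == t),
      X0 *m tr_form C *m X0^T == (h - 1%:M) *m invmx (B n),
      X0 *m tr_form C *m W^T == 0, W *m tr_form C *m X0^T == 0
    & W *m tr_form C *m W^T == 0].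

Let eq_rank_lsubmx a b (X : 'M[F]_(a, s + t)) (Y : 'M[F]_(b, s + t)) :
  (X :=: Y)%MS -> \rank (lsubmx X) = \rank (lsubmx Y).
Proof.
have sub c (Z : 'M[F]_(c, s + t)) : lsubmx Z = Z *m col_mx 1%:M 0.
  by rewrite -{2}[Z]hsubmxK mul_row_col mulmx1 mulmx0 addr0.
by move=> XY; rewrite !sub (eqmxMr _ XY).
Qed.

Let eq_rank_rsubmx a b (X : 'M[F]_(a, s + t)) (Y : 'M[F]_(b, s + t)) :
  (X :=: Y)%MS -> \rank (rsubmx X) = \rank (rsubmx Y).
Proof.
have sub c (Z : 'M[F]_(c, s + t)) : rsubmx Z = Z *m col_mx 0 1%:M.
  by rewrite -{2}[Z]hsubmxK mul_row_col mulmx1 mulmx0 add0r.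
by move=> XY; rewrite !sub (eqmxMr _ XY).
Qed.

(** With C and X0 fixed, the ranks and the vanishing conditions see only the row space of Y. *)
Let good_genmx w C X0 (Y : 'M_(w, s + t)) : good C X0 <<Y>>%MS = good C X0 Y.
Proof.
have E : (col_mx X0 <<Y>>%MS :=: col_mx X0 Y)%MS.
  by apply/eqmxP; rewrite !col_mx_sub -!addsmxE !addsmxSl !(submx_trans _ (addsmxSr _ _)) ?genmxE.
have sub a b (U : 'M_(a, s + t)) (V : 'M_(b, s + t)) : (U <= V)%MS ->
    [&& X0 *m tr_form C *m V^T == 0, V *m tr_form C *m X0^T == 0
      & V *m tr_form C *m V^T == 0] ->
    [&& X0 *m tr_form C *m U^T == 0, U *m tr_form C *m X0^T == 0
      & U *m tr_form C *m U^T == 0].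
  move=> /submxP [Z ->] /and3P [/eqP E1 /eqP E2 /eqP E3].
  rewrite !trmx_mul !mulmxA E1 -!(mulmxA Z) E2 mul0mx mulmx0 eqxx /=.
  by rewrite E3 mul0mx mulmx0 !eqxx.
rewrite /good (eq_rank_lsubmx E) (eq_rank_rsubmx E); congr [&& _, _ & _].
by apply/idP/idP; apply: sub; rewrite genmxE.
Qed.

Lemma good_count_poly C X0 (S : 'M[F]_(s + t)) :
  exp_poly (#|F|)%:R 0 (fun m => (\sum_(a : 'M[F]_(m, s + t)) \sum_(b : 'M[F]_(m, s + t))
     (good C X0 <<col_mx a b>>%MS && (a^T *m b + b^T *m a == S)%R))%N%:R).
Proof. exact: row_space_count_poly (good C X0). Qed.

Variable m : nat.

Let N := (n + m)%N.
Let nmN : (n + m <= N)%N. Proof. by rewrite leqnn. Qed.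
Let nN : (n <= N)%N. Proof. by rewrite leq_addr. Qed.
Let E := inc n N.
Let H := row_mx (hypP F fam n m N) (hypQ F fam n m N).

Let EE : E^T *m E = 1%:M. Proof. exact: incT_inc nmN. Qed.

Let EH : E^T *m H = 0.
Proof. by rewrite mul_mx_row (incT_P _ _ nmN) (incT_Q _ _ nmN) row_mx0. Qed.

Let HE : H^T *m E = 0.
Proof. by rewrite -[LHS]trmxK trmx_mul trmxK EH trmx0. Qed.

Let HH : H^T *m H = 1%:M.
Proof.
rewrite tr_row_mx mul_col_row (PT_P _ _ nmN) (QT_Q _ _ nmN) (PT_Q _ _ nmN) (_ : _ *m _ = 0) -?scalar_mx_block //.
by rewrite -[LHS]trmxK trmx_mul trmxK (PT_Q _ _ nmN) trmx0.
Qed.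

Let EH_complete : E *m E^T + H *m H^T = 1%:M.
Proof. by rewrite tr_row_mx mul_row_col addrA inc_P_Q_complete. Qed.

Let glue (X0 : 'M[F]_(d n, s + t)) (Y : 'M[F]_(m + m, s + t)) := E *m X0 + H *m Y.

Let ET_glue X0 Y : E^T *m glue X0 Y = X0.
Proof. by rewrite mulmxDr !mulmxA EE EH mul1mx mul0mx addr0. Qed.

Let HT_glue X0 Y : H^T *m glue X0 Y = Y.
Proof. by rewrite mulmxDr !mulmxA HE HH mul1mx mul0mx add0r. Qed.

Let big_glue (f : 'M[F]_(d N, s + t) -> nat) :
  (\sum_X f X = \sum_X0 \sum_Y f (glue X0 Y))%N.
Proof.
rewrite pair_bigA /= (reindex (fun p : 'M_(d n, s + t) * 'M_(m + m, s + t) => glue p.1 p.2)) //.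
exists (fun X => (E^T *m X, H^T *m X)) => [[X0 Y]|X] _ /=; first by rewrite ET_glue HT_glue.
by rewrite /glue !mulmxA -mulmxDl EH_complete mul1mx.
Qed.

Let glue_gram X0 a b : (glue X0 (col_mx a b))^T *m B N *m glue X0 (col_mx a b) =
  X0^T *m B n *m X0 + (a^T *m b + b^T *m a).
Proof.
set X := glue _ _; have EX : E^T *m X = X0 by exact: ET_glue.
have := HT_glue X0 (col_mx a b); rewrite -/X tr_row_mx mul_col_mx => /eq_col_mx [PX QX].
clearbody X; rewrite /N (formB_decomp eps m n_min) -/N -/E.
have r c e (U : 'M[F]_(d N, c)) (K : 'M_(c, e)) (V : 'M[F]_(d N, e)) :
  X^T *m (U *m K *m V^T) *m X = (U^T *m X)^T *m K *m (V^T *m X).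
  by rewrite trmx_mul trmxK !mulmxA.
have r1 c (U V : 'M[F]_(d N, c)) : X^T *m (U *m V^T) *m X = (U^T *m X)^T *m (V^T *m X).
  by rewrite trmx_mul trmxK !mulmxA.
by rewrite !(mulmxDr, mulmxDl) r !r1 EX PX QX.
Qed.

Let gram_block (C : 'M[F]_(s, t)) : 'M[F]_(s + t) :=
  block_mx (wall_gram A) C C^T (wall_gram A').

Let gram_blockE (X : 'M_(d N, s + t)) C :
  (X^T *m B N *m X == gram_block C) =
  [&& ((lsubmx X)^T *m B N *m lsubmx X == wall_gram A),
      ((rsubmx X)^T *m B N *m rsubmx X == wall_gram A')
    & C == ursubmx (X^T *m B N *m X)].
Proof.
have [I [J ->]] : exists I J, X = row_mx I J by exists (lsubmx X), (rsubmx X); rewrite hsubmxK.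
rewrite row_mxKl row_mxKr !gram_row_mx block_mxKur.
apply/eqP/and3P => [/eq_block_mx [-> -> _ ->]|[/eqP -> /eqP -> /eqP ->]] //.
by rewrite /gram_block tr_gram.
Qed.

Let glue_eqmx X0 Y : (glue X0 Y :=: col_mx X0 Y)%MS.
Proof.
apply/eqmxP; rewrite {1}/glue -mul_row_col submxMl col_mx_sub /=.
have := (submxMl E^T (glue X0 Y), submxMl H^T (glue X0 Y)).
by rewrite ET_glue HT_glue => -[-> ->].
Qed.

(** Compare the four blocks relative to E and H: the embedded h differs from 1 only in the block of
    V_n. *)
Let glue_wall X0 Y C :
  (1%:M + glue X0 Y *m tr_form C *m (glue X0 Y)^T *m B N == embed N h) =
  [&& X0 *m tr_form C *m X0^T == (h - 1%:M) *m invmx (B n),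
      X0 *m tr_form C *m Y^T == 0, Y *m tr_form C *m X0^T == 0
    & Y *m tr_form C *m Y^T == 0].
Proof.
have Bu := formB_unit eps_neq0 n_min.
have BNu : B N \in unitmx by apply: formB_unit => //; exact: leq_trans nN.
set D := (h - 1%:M) *m invmx (B n).
have -> : embed N h = 1%:M + E *m D *m E^T *m B N.
  have -> : E *m D *m E^T *m B N = E *m D *m (E^T *m B N) by rewrite mulmxA.
  by rewrite (incT_form eps n_min nN) mulmxA -(mulmxA E) mulmxKV // (embedE nmN).
rewrite (inj_eq (addrI _)) (can_eq (mulmxK BNu)).
set X := glue X0 Y; have EX : E^T *m X = X0 by exact: ET_glue.
have HX : H^T *m X = Y by exact: HT_glue.
have XE : X^T *m E = X0^T by rewrite -EX trmx_mul trmxK.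
have XH : X^T *m H = Y^T by rewrite -HX trmx_mul trmxK.
apply/eqP/and4P => [XX|[/eqP E1 /eqP E2 /eqP E3 /eqP E4]].
  have r a b (U : 'M[F]_(d N, a)) (V : 'M[F]_(d N, b)) :
      (U^T *m X) *m tr_form C *m (X^T *m V) = U^T *m E *m D *m (E^T *m V).
    transitivity (U^T *m (X *m tr_form C *m X^T) *m V); first by rewrite !mulmxA.
    by rewrite XX !mulmxA.
  have := (r _ _ E E, r _ _ E H, r _ _ H E, r _ _ H H).
  rewrite EX HX XE XH EE EH HE !(mulmx0, mul0mx) mul1mx mulmx1.
  by move=> [[[-> ->] ->] ->].
rewrite /X /glue trmxD !trmx_mul !(mulmxDl, mulmxDr).
have r a c (U : 'M[F]_(d N, a)) (U' : 'M[F]_(a, s + t)) (V' : 'M_(c, s + t)) (V : 'M[F]_(d N, c)) :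
    U *m U' *m tr_form C *m (V'^T *m V^T) = U *m (U' *m tr_form C *m V'^T) *m V^T.
  by rewrite !mulmxA.
by rewrite !r E1 E2 E3 E4 !mulmx0 !mul0mx !addr0.
Qed.

Let frame_pair_glue X0 a b :
  (frame_pair (embed N h) (lsubmx (glue X0 (col_mx a b))) (rsubmx (glue X0 (col_mx a b))) : nat) =
  (\sum_(C : 'M[F]_(s, t)) (good C X0 <<col_mx a b>>%MS
     && (a^T *m b + b^T *m a == gram_block C - X0^T *m B n *m X0)%R))%N.
Proof.
set Y := col_mx a b; set X := glue X0 Y; set C0 := ursubmx (X^T *m B N *m X).
have gE C : (a^T *m b + b^T *m a == gram_block C - X0^T *m B n *m X0) =
    (X^T *m B N *m X == gram_block C).
  by rewrite /X /Y glue_gram eq_sym subr_eq eq_sym [X in X == _]addrC.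
(* Summing over C linearises the dependence on I^T B J: only its actual value [C0] contributes. *)
rewrite (bigD1 C0) //= [X in (_ + X)%N]big1 ?addn0 => [|C nC]; last first.
  by rewrite gE gram_blockE (negbTE nC) !andbF.
congr nat_of_bool; rewrite good_genmx gE gram_blockE eqxx andbT /frame_pair /frame wall_mul -/C0.
rewrite glue_wall /good -(eq_rank_lsubmx (glue_eqmx X0 Y)) -(eq_rank_rsubmx (glue_eqmx X0 Y)) -/X.
rewrite /row_free !mxrank_tr.
by rewrite -!andbA; do ![bool_congr].
Qed.

Lemma prodCoef_frame_sum :
  (stab_card A * stab_card A')%N%:R * prodCoef eps mu nu (embed N h) =
  \sum_(X0 : 'M[F]_(d n, s + t)) \sum_(C : 'M[F]_(s, t))
    (\sum_(a : 'M[F]_(m, s + t)) \sum_(b : 'M[F]_(m, s + t))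
      (good C X0 <<col_mx a b>>%MS && (a^T *m b + b^T *m a == gram_block C - X0^T *m B n *m X0)%R))%N%:R.
Proof.
rewrite prodCoef_frames ?(leq_trans n_min) // big_frames big_glue natr_sum.
apply: eq_bigr => X0 _; rewrite big_col_mx -natr_sum; congr (_%:R).
rewrite [RHS]exchange_big; apply: eq_bigr => a _; rewrite [RHS]exchange_big /=.
by apply: eq_bigr => b _; exact: frame_pair_glue.
Qed.

End OneElement.

(** The ranges of X0 and C do not depend on m, so a finite sum of row space counts remains, divided
    by the two stabiliser orders. *)
Lemma prodCoef_embed_poly n (h : 'M[F]_(d n)) : (nmin fam <= n)%N ->
  exp_poly (#|F|)%:R 0 (fun m => prodCoef eps mu nu (embed (n + m) h)).
Proof.
move=> n1; have z0 : (stab_card A * stab_card A')%N%:R != 0 :> rat.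
  by rewrite pnatr_eq0 -lt0n muln_gt0 !stab_card_gt0.
apply: (eq_exp_poly (fun m => canRL (mulKf z0) (prodCoef_frame_sum h n1 m))).
apply: exp_polyZ; apply: exp_poly_sum => X0 _; apply: exp_poly_sum => C _.
exact: good_count_poly.
Qed.

End TwoTypes.

End Count.

(** * Types and the theorem *)

Section Types.

Variables (F : finFieldType) (eps : F) (fam : ofamily).
Hypothesis eps_neq0 : eps != 0.
Hypothesis two_neq0 : 2%:R != 0 :> F.

Local Notation d n := (fdim fam n).
Local Notation q := #|F|.

Let q_gt1 : (1 < q)%N.
Proof. exact: finNzRing_gt1. Qed.

Lemma hasType_wall_type (mu : elt F fam) s (A : 'M_s) n (g : 'M_(d n)) :
  (nmin fam <= projT1 mu)%N -> inG eps (projT2 mu) -> A \in unitmx ->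
  wall_type eps (projT2 mu) A -> (nmin fam <= n)%N ->
  hasType eps g mu <-> inG eps g /\ wall_type eps g A.
Proof.
move=> mu1 muG Au muA n1; rewrite (hasTypeP eps_neq0 two_neq0 mu1 muG Au muA) //.
split=> [[I /andP [fI SI] ->]|[gG [I fI gE]]].
  by rewrite wall_isometry_gram //; split => //; exists I.
by exists I; rewrite // /frame fI -wall_isometry_gram // -gE.
Qed.

Lemma sametype_sym (a b : elt F fam) :
  (nmin fam <= projT1 a)%N -> (nmin fam <= projT1 b)%N ->
  inG eps (projT2 a) -> inG eps (projT2 b) -> sametype eps a b -> sametype eps b a.
Proof.
move=> a1 b1 aG bG ab; have [A Au Ha] := wall_exists eps_neq0 a1 aG.
have Hb := sametype_wall_type eps_neq0 Au a1 b1 bG ab Ha.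
exact: wall_type_sametype Hb Ha.
Qed.

Lemma sametype_trans (a b c : elt F fam) :
  (nmin fam <= projT1 a)%N -> (nmin fam <= projT1 b)%N -> (nmin fam <= projT1 c)%N ->
  inG eps (projT2 a) -> inG eps (projT2 b) -> inG eps (projT2 c) ->
  sametype eps a b -> sametype eps b c -> sametype eps a c.
Proof.
move=> a1 b1 c1 aG bG cG ab bc; have [A Au Ha] := wall_exists eps_neq0 a1 aG.
have Hb := sametype_wall_type eps_neq0 Au a1 b1 bG ab Ha.
have Hc := sametype_wall_type eps_neq0 Au b1 c1 cG bc Hb.
exact: wall_type_sametype Ha Hc.
Qed.

Lemma finitely_many_types r0 : exists (k : nat) (lam : 'I_k -> elt F fam),
  [/\ forall i, (nmin fam <= projT1 (lam i))%N /\ inG eps (projT2 (lam i)),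
      forall i j, i != j -> ~ sametype eps (lam i) (lam j)
    & forall e : elt F fam, (nmin fam <= projT1 e)%N -> inG eps (projT2 e) ->
        (\rank (projT2 e - 1%:M)%R <= r0)%N -> exists i, sametype eps e (lam i)].
Proof.
(* Over a finite field there are finitely many matrices A of size at most r0. The list of them is
   scanned, and a representative is added whenever a matrix gives a type not yet met. *)
pose data (e : elt F fam) (x : {r : 'I_r0.+1 & 'M[F]_r}) :=
  tagged x \in unitmx /\ wall_type eps (projT2 e) (tagged x).
suff H (l : seq {r : 'I_r0.+1 & 'M[F]_r}) : exists (k : nat) (lam : 'I_k -> elt F fam),
  [/\ forall i, (nmin fam <= projT1 (lam i))%N /\ inG eps (projT2 (lam i)),
      forall i j, i != j -> ~ sametype eps (lam i) (lam j)
    & forall (e : elt F fam) x, (nmin fam <= projT1 e)%N -> inG eps (projT2 e) ->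
        data e x -> x \in l -> exists i, sametype eps e (lam i)].
  have [k [lam [H1 H2 H3]]] := H (enum {: {r : 'I_r0.+1 & 'M[F]_r}}).
  exists k, lam; split => // e e1 eG er; have [A Au eA] := wall_exists eps_neq0 e1 eG.
  apply: (H3 e (existT (fun r : 'I_r0.+1 => 'M[F]_r) (Ordinal (er : (_ < r0.+1)%N)) A)) => //.
  by rewrite mem_enum.
elim: l => [|x l [k [lam [H1 H2 H3]]]]; first by exists 0%N, (fun=> existT (fun n => 'M[F]_(fdim fam n)) 0%N (const_mx 0)); split => // -[].
have [[e0 [[e01 e0G] e0x e0n]]|no] := pselect (exists e0 : elt F fam,
    [/\ (nmin fam <= projT1 e0)%N /\ inG eps (projT2 e0), data e0 x
      & ~ exists i, sametype eps e0 (lam i)]); last first.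
  exists k, lam; split => // e y e1 eG ey; rewrite inE => /predU1P [yx|yl]; last exact: (H3 e y).
  by apply: contrapT => ne; apply: no; exists e; rewrite -yx.
exists k.+1, (fun i => oapp lam e0 (unlift ord0 i)); split.
- by move=> i; case: unliftP => [j _|_] /=.
- move=> i j; case: unliftP => [i' ->|->]; case: unliftP => [j' ->|->] /=.
  + by rewrite (inj_eq lift_inj); exact: H2.
  + move=> _ S; apply: e0n; exists i'; have [l1 lG] := H1 i'.
    exact: sametype_sym S.
  + by move=> _ S; apply: e0n; exists j'.
  + by [].
- move=> e y e1 eG ey; rewrite inE => /predU1P [yx|yl].
    exists ord0; rewrite unlift_none /=; move: ey e0x; rewrite yx => -[xu ex] [_ e0x].
    exact: (wall_type_sametype eps_neq0 two_neq0 xu).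
  have [i S] := H3 e y e1 eG ey yl.
  by exists (lift ord0 i); rewrite liftK.
Qed.

Lemma inc_mx_id n : inc_mx F fam n n = 1%:M.
Proof. by apply/matrixP => i j; rewrite !mxE. Qed.

Lemma embed_id n (g : 'M[F]_(d n)) : embed n g = g.
Proof.
have nn : (n + 0 <= n)%N by rewrite addn0.
by rewrite (embedE nn) inc_mx_id trmx1 mul1mx mulmx1 addrC subrK.
Qed.

Lemma qint_inj : injective (qint q).
Proof.
move=> i j ij; have : q%:R ^+ i = q%:R ^+ j :> rat by rewrite !(qint_exp q_gt1) ij.
by move=> /eqP; rewrite -!natrX eqr_nat eqn_exp2l // => /eqP.
Qed.

(** The numbers [M] are pairwise distinct, so a nonzero difference would have too many roots. *)
Lemma poly_eq_at_qint (p p' : {poly rat}) N0 :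
  (forall M, (N0 <= M)%N -> p.[qint q M] = p'.[qint q M]) -> p = p'.
Proof.
move=> H; apply/eqP; rewrite -subr_eq0; apply/eqP/eqP; apply: contraTT isT => p0.
pose rs := [seq qint q M | M <- iota N0 (size (p - p'))].
have : (size rs < size (p - p')%R)%N.
  apply: max_poly_roots => //; last by rewrite map_inj_uniq ?iota_uniq //; exact: qint_inj.
  apply/allP => x /mapP [M]; rewrite mem_iota => /andP [NM _] ->.
  by rewrite /root !hornerE H // subrr.
by rewrite size_map size_iota ltnn.
Qed.

(** * Coefficients of the product as polynomials attached to types *)

Section Product.

Variables (mu nu : elt F fam).
Hypotheses (mu1 : (nmin fam <= projT1 mu)%N) (muG : inG eps (projT2 mu)).
Hypotheses (nu1 : (nmin fam <= projT1 nu)%N) (nuG : inG eps (projT2 nu)).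

Lemma hasType_conj (la : elt F fam) n (c g : 'M_(d n)) :
  (nmin fam <= projT1 la)%N -> inG eps (projT2 la) -> (nmin fam <= n)%N ->
  inG eps c -> hasType eps (invmx c *m g *m c) la = hasType eps g la.
Proof.
move=> la1 laG n1 cG; have [A Au laA] := wall_exists eps_neq0 la1 laG.
have W (h : 'M_(d n)) := hasType_wall_type h la1 laG Au laA n1.
have sub (b h : 'M_(d n)) : inG eps b -> hasType eps h la -> hasType eps (invmx b *m h *m b) la.
  move=> bG /W [hG hA]; have bu := inG_unit eps_neq0 n1 bG.
  by apply/W; split; [rewrite !inG_mul ?inG_inv | exact: wall_type_conj].
have cu := inG_unit eps_neq0 n1 cG.
apply/idP/idP => [/(sub (invmx c))|]; last exact: sub.
by rewrite invmxK inG_inv // !mulmxA mulmxV // mul1mx mulmxK //; apply.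
Qed.

Lemma prodCoef_conj n (c h : 'M_(d n)) : (nmin fam <= n)%N -> inG eps c ->
  prodCoef eps mu nu (invmx c *m h *m c) = prodCoef eps mu nu h.
Proof.
move=> n1 cG; have cu := inG_unit eps_neq0 n1 cG; rewrite /prodCoef.
have cj_inj : injective (fun x : 'M_(d n) => invmx c *m x *m c).
  by move=> x y /(can_inj (mulmxK cu)) /(can_inj (mulKVmx cu)).
rewrite (reindex_inj cj_inj); apply: eq_bigr => x _.
rewrite (reindex_inj cj_inj); apply: eq_big => [y|y _]; last by rewrite !hasType_conj.
by rewrite !mulmxA mulmxK // -!mulmxA !(can_eq (mulKVmx cu)) !mulmxA (can_eq (mulmxK cu)).
Qed.

Lemma prodCoef_int n (h : 'M_(d n)) : prodCoef eps mu nu h \is a Num.int.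
Proof. by apply: rpred_sum => x _; apply: rpred_sum => y _; exact: rpred_nat. Qed.

Lemma prodCoef_poly n (h : 'M_(d n)) : (nmin fam <= n)%N ->
  exists2 r : {poly rat}, inRq q r &
    forall M, (n <= M)%N -> prodCoef eps mu nu (embed M h) = r.[qint q M].
Proof.
move=> n1; have [A Au muA] := wall_exists eps_neq0 mu1 muG.
have [A' Au' nuA'] := wall_exists eps_neq0 nu1 nuG.
have [p Hp] := prodCoef_embed_poly eps_neq0 two_neq0 mu1 muG nu1 nuG Au muA Au' nuA' h n1.
(* For M = n + k the count is a polynomial in q^k, and q^k = q^(-n) (1 + (q - 1)[M]). *)
pose r := p \Po ((q%:R ^+ n)^-1 *: (1 + (q%:R - 1) *: 'X)).
have rE M : (n <= M)%N -> prodCoef eps mu nu (embed M h) = r.[qint q M].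
  move=> nM; have [k ->] : exists k, M = (n + k)%N by exists (M - n)%N; rewrite subnKC.
  rewrite Hp mul0n expr0 mul1r /r horner_comp hornerZ hornerD hornerZ hornerX hornerC.
  rewrite -(qint_exp q_gt1) exprD mulKf //.
  by rewrite expf_neq0 // (q_neq0 q_gt1).
exists r => //; apply: (inRq_large_values q_gt1 (n := n)) => M nM.
by rewrite -rE // prodCoef_int.
Qed.

(** h may live at a level m below that of [la]. Its own polynomial r' agrees with r at every large
    M, where the two images are conjugate, so r = r', and r' may be evaluated at m itself. *)
Lemma prodCoef_sametype_poly (la : elt F fam) (r : {poly rat}) m (h : 'M_(d m)) :
  (nmin fam <= projT1 la)%N -> inG eps (projT2 la) ->
  (forall M, (projT1 la <= M)%N -> prodCoef eps mu nu (embed M (projT2 la)) = r.[qint q M]) ->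
  (nmin fam <= m)%N -> inG eps h -> sametype eps la (existT _ m h) ->
  prodCoef eps mu nu h = r.[qint q m].
Proof.
move=> la1 laG Hr m1 hG S; have [r' _ Hr'] := prodCoef_poly h m1.
have [A Au laA] := wall_exists eps_neq0 la1 laG.
have hA := sametype_wall_type eps_neq0 Au la1 (m1 : (_ <= projT1 (existT _ m h))%N) hG S laA.
have [N0 HN0] := wall_type_conj_stable eps_neq0 two_neq0 Au la1 (m1 : (_ <= projT1 (existT _ m h))%N) laG hG laA hA.
suff -> : r = r' by rewrite -Hr' // embed_id.
apply: (@poly_eq_at_qint _ _ N0) => M /HN0 [laM mM [c [cG cu E]]].
by rewrite -Hr // -Hr' // E prodCoef_conj // (leq_trans m1).
Qed.

(** From xy - 1 = (x - 1) y + (y - 1) the rank is subadditive; this bounds the types that can occur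
    in the product. *)
Lemma prodCoef_support m (h : 'M_(d m)) : (nmin fam <= m)%N ->
  prodCoef eps mu nu h != 0 ->
  inG eps h /\
  (\rank (h - 1%:M)%R <= \rank (projT2 mu - 1%:M)%R + \rank (projT2 nu - 1%:M)%R)%N.
Proof.
move=> m1 nz; have [A Au muA] := wall_exists eps_neq0 mu1 muG.
have [A' Au' nuA'] := wall_exists eps_neq0 nu1 nuG.
have [x [y [/eqP <- hx hy]]] : exists x y, [/\ x *m y == h, hasType eps x mu & hasType eps y nu].
  apply: contrapT => no; case/eqP: nz; apply: big1 => x _; apply: big1 => y xy.
  case hx : (hasType eps x mu); case hy : (hasType eps y nu) => //.
  by case: no; exists x, y.
have /(hasType_wall_type _ mu1 muG Au muA m1) [xG [I _ xE]] := hx.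
have /(hasType_wall_type _ nu1 nuG Au' nuA' m1) [yG [J _ yE]] := hy.
split; first exact: inG_mul.
have -> : x *m y - 1%:M = (x - 1%:M) *m y + (y - 1%:M).
  by rewrite mulmxBl mul1mx addrA subrK.
have rk s (K : 'M_s) (L : 'M_(d m, s)) : (\rank (wall eps K L - 1%:M)%R <= s)%N.
  rewrite /wall [1%:M + _]addrC addrK -!mulmxA.
  exact: leq_trans (mxrankM_maxl _ _) (rank_leq_col _).
apply: leq_trans (mxrank_add _ _) _; apply: leq_add; last by rewrite yE.
by apply: leq_trans (mxrankM_maxl _ _) _; rewrite xE.
Qed.

End Product.

End Types.

Lemma odd_two_neq0 (F : finFieldType) : odd #|F| -> 2%:R != 0 :> F.
Proof.
apply: contraTN => /eqP F2.
(* If 2 = 0, then 1 has additive order 2, which would divide the odd order of F. *)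
have o2 : #[1%R : F]%g = 2%N by rewrite (nt_prime_order (p := 2)) // ?oner_eq0 // FinRing.zmodXgE.
by have := order_dvdG (in_setT (1%R : F)); rewrite o2 cardsT dvdn2.
Qed.

Theorem theorem8p17 (F : finFieldType) (eps : F) (fam : ofamily)
  (Hq : odd #|F|) (Heps : forall y : F, y ^+ 2 != eps)
  (mu nu : elt F fam)
  (Hmu : (nmin fam <= projT1 mu)%N) (Gmu : inG eps (projT2 mu))
  (Hnu : (nmin fam <= projT1 nu)%N) (Gnu : inG eps (projT2 nu)) :
  exists (k : nat) (lam : 'I_k -> elt F fam) (r : 'I_k -> {poly rat}),
    [/\ forall i, (nmin fam <= projT1 (lam i))%N /\ inG eps (projT2 (lam i)),
        forall i j, i != j -> ~ sametype eps (lam i) (lam j),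
        forall i, inRq #|F| (r i) &
        forall m : nat, (nmin fam <= m)%N ->
          forall h : 'M[F]_(fdim fam m),
            prodCoef eps mu nu h =
            \sum_(i < k) (r i).[qint #|F| m] * XCoef eps (lam i) h].
Proof.
have eps_neq0 : eps != 0 by have := Heps 0; rewrite expr0n eq_sym.
have two_neq0 := odd_two_neq0 Hq.
have [k [lam [lam_ok lam_distinct lam_all]]] := finitely_many_types fam eps_neq0 two_neq0
  (\rank (projT2 mu - 1%:M)%R + \rank (projT2 nu - 1%:M)%R)%N.
(* The coefficient polynomial of each type is read off from its representative. *)
have poly_ex i : exists r : {poly rat}, inRq #|F| r /\
    forall M, (projT1 (lam i) <= M)%N -> prodCoef eps mu nu (embed M (projT2 (lam i))) = r.[qint #|F| M].
  have [l1 lG] := lam_ok i.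
  have [r r_in Hr] := prodCoef_poly eps_neq0 two_neq0 Hmu Gmu Hnu Gnu (projT2 (lam i)) l1.
  by exists r.
have [r Hr] := choice poly_ex.
exists k, lam, r; split => //; first by move=> i; case: (Hr i).
(* If h has one of the listed types, distinctness leaves a single term. Otherwise the right-hand
   side is 0, and a nonzero coefficient would bound the rank of h - 1 and put its type on the
   list. *)
move=> m m1 h; case: (boolP [exists i, hasType eps h (lam i)]) => [/existsP [i hi]|/existsPn none].
  have [l1 lG] := lam_ok i; have /andP [hG /asboolP hS] := hi.
  have lh : sametype eps (lam i) (existT _ m h) by exact: (sametype_sym eps_neq0 two_neq0).
  rewrite (bigD1 i) //= big1 => [|j ji]; last first.
    rewrite /XCoef (_ : hasType _ _ _ = false) ?mulr0 //.
    apply/negP => /andP [_ /asboolP hj]; have [l1' lG'] := lam_ok j.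
    by apply: (lam_distinct i j); rewrite 1?eq_sym //; exact: (sametype_trans eps_neq0 two_neq0 l1 _ l1' lG _ lG' lh hj).
  rewrite addr0 /XCoef hi mulr1.
  exact: (prodCoef_sametype_poly eps_neq0 two_neq0 Hmu Gmu Hnu Gnu l1 lG (proj2 (Hr i)) m1 hG lh).
rewrite big1 => [|i _]; last by rewrite /XCoef (negbTE (none i)) mulr0.
apply: contraTeq isT => /(prodCoef_support eps_neq0 two_neq0 Hmu Gmu Hnu Gnu m1) [hG hr].
have [i Si] := lam_all (existT _ m h) m1 hG hr.
by have := none i; rewrite /hasType hG; case: asboolP.
Qed.
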